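(* Let $\mu_1,\mu_2\in\mathcal M_*$. There exist two functions $Z_1$ and $Z_2$ in the set $\mathcal S_*$ such that $$Z_1(z)Z_2(z)=zQ_{\mu_1}(Z_1(z))\quad\text{and}\quad Q_{\mu_1}(Z_1(z))=Q_{\mu_2}(Z_2(z)),\qquad z\in\mathbb D.$$ The functions $Z_1$ and $Z_2$ are the unique solutions of these equations in the class $\mathcal S_*$.
   Context: $\mathbb D=\{z\in\mathbb C:|z|<1\}$ and $\mathbb T$ is the unit circle. $\mathcal M_*$ is the set of Borel probability measures $\mu$ on $\mathbb T$ with $\int_{\mathbb T}\xi\,\mu(d\xi)\ne0$. For $\mu\in\mathcal M_*$ and $z\in\mathbb D$ put $\psi_\mu(z)=\int_{\mathbb T}\frac{z\xi}{1-z\xi}\,\mu(d\xi)$ and $Q_\mu(z)=\psi_\mu(z)/(1+\psi_\mu(z))$. $\mathcal S$ (the Schur class) is the class of analytic functions $\mathbb D\to\overline{\mathbb D}$, and $\mathcal S_*$ is the subclass of those $Q\in\mathcal S$ with $Q(0)=0$ and $Q'(0)\ne0$. *)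

(* Defs.v *)
From HB Require Import structures.
From mathcomp Require Import all_boot all_order all_algebra.
From mathcomp Require Import complex.
From mathcomp Require Import all_classical all_reals all_analysis.

Set Implicit Arguments.
Unset Strict Implicit.
Unset Printing Implicit Defensive.

Import Order.TTheory GRing.Theory Num.Theory.
Import numFieldNormedType.Exports.

Local Open Scope classical_set_scope.
Local Open Scope ring_scope.
Local Open Scope complex_scope.

(* R[i] carries the norm topology of the numeric field R[i] regarded as a
   normed module over itself, so that limits, open sets and the derivative
   derive1 f of f : R[i] -> R[i] are the complex ones. The norm `|z| is valued
   in R[i], where x <= y means that y - x is a nonnegative real number. *)
HB.instance Definition _ (R : rcfType) := NormedModule.copy R[i] R[i]^o.

Definition unit_disc (R : realType) : set R[i] := [set z | `|z| < 1].
Arguments unit_disc R : clear implicits.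

Definition unit_circle (R : realType) : set R[i] := [set z | `|z| = 1].
Arguments unit_circle R : clear implicits.

(* The circle as a type, with the topology induced by R[i]. *)
Definition circle (R : realType) : Type := set_type (unit_circle R).
HB.instance Definition _ (R : realType) := Topological.on (circle R).

Lemma unit_circle1 (R : realType) : (1 : R[i]) \in unit_circle R.
Proof. by rewrite inE /unit_circle /= normr1. Qed.

(* The library requires a measurable space to have a distinguished point. *)
HB.instance Definition _ (R : realType) :=
  isPointed.Build (circle R) (exist _ 1 (unit_circle1 R)).

Definition borel_circle (R : realType) :=
  g_sigma_algebraType (@open (circle R)).

Definition circle_val (R : realType) (xi : borel_circle R) : R[i] :=
  \val (xi : set_type (unit_circle R)).

Definition Cintegral d (T : measurableType d) (R : realType)
    (mu : {measure set T -> \bar R}) (f : T -> R[i]) : R[i] :=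
  (\int[mu]_x complex.Re (f x)) +i* (\int[mu]_x complex.Im (f x)).

Definition nonzero_mean (R : realType)
    (mu : probability (borel_circle R) R) : Prop :=
  Cintegral mu (fun xi => circle_val xi) != 0.

Definition psi (R : realType) (mu : probability (borel_circle R) R)
    (z : R[i]) : R[i] :=
  Cintegral mu (fun xi => z * circle_val xi / (1 - z * circle_val xi)).

Definition Qfun (R : realType) (mu : probability (borel_circle R) R)
    (z : R[i]) : R[i] :=
  psi mu z / (1 + psi mu z).

(* Sum of a convergent power series in some neighbourhood of z0. *)
Definition analytic_at (R : realType) (f : R[i] -> R[i]) (z0 : R[i]) : Prop :=
  exists a : nat -> R[i], \forall z \near z0,
    series (fun n => a n * (z - z0) ^+ n) @ \oo --> f z.

(* Functions on the disc are total functions R[i] -> R[i] whose values outside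
   the disc are irrelevant. *)
Definition schur_class (R : realType) (f : R[i] -> R[i]) : Prop :=
  (forall z, unit_disc R z -> analytic_at f z) /\
  (forall z, unit_disc R z -> `|f z| <= 1).

Definition schur_class_star (R : realType) (f : R[i] -> R[i]) : Prop :=
  [/\ schur_class f, f 0 = 0 & derive1 f 0 != 0].

(* Main.v *)
Require Import Defs.
From mathcomp Require Import all_boot all_order all_algebra.
From mathcomp Require Import cyclic separable cyclotomic complex.
From mathcomp Require Import all_classical all_reals all_analysis measurable_realfun.
From mathcomp Require Import ring lra.

Set Implicit Arguments.
Unset Strict Implicit.
Unset Printing Implicit Defensive.

Import Order.TTheory GRing.Theory Num.Theory.
Import numFieldNormedType.Exports.
Import Normc.

Local Open Scope classical_set_scope.
Local Open Scope ring_scope.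

(** The theorem is a fixed-point statement. Writing [G z] for the integral of
    [1 / (1 - z xi)] against [mu], one has [psi = G - 1] and
    [Qfun mu = 1 - 1 / G]. The map [w |-> 1 / (1 - w)] sends the disc into the
    half-plane [Re > 1 / 2], so the average [G] has real part at least [1 / 2],
    and therefore [Qfun mu] is a Schur function vanishing at the origin. By
    Schwarz's lemma [Qfun mu z = z * K z] with [K] again a Schur function, and
    [K 0] is the mean of [mu], which is nonzero ([Qfun_factor]). Cancelling [Z1]
    and [Z2] turns the system into [Z2 = z K1(Z1)] and [Z1 = z K2(Z2)], that is,
    [Z1 z] is a fixed point of [w |-> z K2(z K1(w))].

    Existence ([fixed_point_holo]). The iterates starting at [0] are analytic
    on the disc and bounded by [|z|]. Near the origin the map contracts with
    factor [16 |z| ^ 2], so the difference of two successive iterates vanishes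
    at [0] to an order at least [n]; as it is bounded by [2] on the disc, it is
    at most [2 |z| ^ n / (1 - |z|)] on the whole disc. Hence the iterates
    converge uniformly on smaller discs, and the limit is analytic.

    Uniqueness ([subordination_unique]). A function of the class has an isolated
    zero at [0], so the cancellation is legitimate near [0]; there the same
    contraction identifies two solutions, and the identity theorem propagates
    the equality to the disc.

    The function theory this takes is developed from one tool, Cauchy's estimate
    for the coefficients of a power series ([cauchy_estimate]), obtained by
    averaging over roots of unity. It gives Weierstrass's theorem on uniform
    limits ([holo_uniform_limit]); products, compositions, inverses and changes
    of centre are then uniform limits of expressions that are visibly power
    series. *)

(** * The real-valued modulus *)

Section Modulus.
Variable R : realType.
Local Notation C := R[i].
Implicit Types z w : C.

Lemma normE z : `|z| = ((normc z)%:C)%C.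
Proof. by rewrite normc_def; case: z. Qed.

Lemma normc_ge0 z : 0 <= normc z.
Proof. by case: z => a b; exact: sqrtr_ge0. Qed.

Lemma normcD z w : normc (z + w) <= normc z + normc w.
Proof. exact: le_normcD. Qed.

Lemma normcB z w : normc (z - w) <= normc z + normc w.
Proof. by rewrite -(normcN w) normcD. Qed.

Lemma distcC z w : normc (z - w) = normc (w - z).
Proof. by rewrite -normcN opprB. Qed.

Lemma normc0E : normc (0 : C) = 0.
Proof. exact: normc0. Qed.

Lemma normc1E : normc (1 : C) = 1.
Proof. exact: normc1. Qed.

Lemma normc_eq0 z : (normc z == 0) = (z == 0).
Proof. by apply/eqP/eqP => [/eq0_normc|->]//; exact: normc0E. Qed.

Lemma normc_gt0 z : (0 < normc z) = (z != 0).
Proof. by rewrite lt_def normc_ge0 andbT normc_eq0. Qed.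

Lemma normcX z n : normc (z ^+ n) = normc z ^+ n.
Proof. by elim: n => [|n IH]; rewrite ?expr0 ?normc1E// !exprS normcM IH. Qed.

Lemma normc_real (x : R) : normc (x%:C)%C = `|x|.
Proof. by rewrite /normc/= expr0n/= addr0 sqrtr_sqr. Qed.

Lemma normc_nat n : normc (n%:R : C) = n%:R.
Proof. by rewrite -(rmorph_nat (real_complex R)) normc_real normr_nat. Qed.

Lemma normc_sum (I : Type) (r : seq I) (P : pred I) (F : I -> C) :
  normc (\sum_(i <- r | P i) F i) <= \sum_(i <- r | P i) normc (F i).
Proof.
elim/big_ind2 : _ => //; first by rewrite normc0E.
by move=> x1 x2 y1 y2 h1 h2; apply: le_trans (normcD _ _) (lerD h1 h2).
Qed.

Lemma ler_Re z : `|complex.Re z| <= normc z.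
Proof.
case: z => a b /=; rewrite -sqrtr_sqr ler_wsqrtr// lerDl; exact: sqr_ge0.
Qed.

Lemma ler_Im z : `|complex.Im z| <= normc z.
Proof.
case: z => a b /=; rewrite -sqrtr_sqr ler_wsqrtr// lerDr; exact: sqr_ge0.
Qed.

Lemma normc_le z : normc z <= `|complex.Re z| + `|complex.Im z|.
Proof.
case: z => a b /=.
rewrite -[leRHS]ger0_norm ?addr_ge0// -sqrtr_sqr ler_wsqrtr//.
have := mulr_ge0 (normr_ge0 a) (normr_ge0 b).
by rewrite sqrrD !real_normK ?num_real//; lra.
Qed.

Lemma normc_sqr z :
  normc z ^+ 2 = complex.Re z ^+ 2 + complex.Im z ^+ 2.
Proof. by case: z => a b /=; rewrite sqr_sqrtr// addr_ge0 ?sqr_ge0. Qed.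

Lemma ltcP (e : R) z : (`|z| < (e%:C)%C) = (normc z < e).
Proof. by rewrite normE ltcR. Qed.

Lemma unit_discE z : unit_disc R z = (normc z < 1) :> Prop.
Proof. by rewrite /unit_disc/= -ltcP. Qed.

(** The norm of [R[i]] takes its values in [R[i]], which is only partially
    ordered; passing to [normc] lets all estimates be carried out in the
    ordered field [R]. *)
Lemma cvgcP (T : Type) (F : set_system T) {FF : Filter F} (f : T -> C) l :
  f @ F --> l <-> (fun x => normc (l - f x)) @ F --> (0 : R).
Proof.
split.
  move=> /cvgrPdist_lt fl; apply/cvgrPdist_lt => e e0.
  have /fl : 0 < (e%:C)%C by rewrite ltcR.
  apply: filterS => x; rewrite ltcP sub0r normrN ger0_norm//.
  exact: normc_ge0.
move=> /cvgrPdist_lt fl; apply/cvgrPdist_lt => e e0.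
have eE : e = ((complex.Re e)%:C)%C.
  by case: e e0 => a b; rewrite ltcE/= => /andP[/eqP -> _].
have /fl : 0 < complex.Re e by move: e0; rewrite eE ltcR.
apply: filterS => x; rewrite sub0r normrN ger0_norm ?normc_ge0//.
by rewrite eE ltcP.
Qed.

Lemma cvgcPlt (T : Type) (F : set_system T) {FF : Filter F} (f : T -> C) l :
  f @ F --> l <-> forall e : R, 0 < e -> \forall x \near F, normc (l - f x) < e.
Proof.
rewrite cvgcP; split=> [/cvgrPdist_lt h e /h|h].
  by apply: filterS => x; rewrite sub0r normrN ger0_norm// normc_ge0.
apply/cvgrPdist_lt => e /h; apply: filterS => x.
by rewrite sub0r normrN ger0_norm// normc_ge0.
Qed.

Lemma cvg_Re (T : Type) (F : set_system T) {FF : Filter F} (f : T -> C) l :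
  f @ F --> l -> complex.Re (f x) @[x --> F] --> complex.Re l.
Proof.
move=> /cvgcPlt fl; apply/cvgrPdist_lt => e /fl; apply: filterS => x.
by apply: le_lt_trans; have := ler_Re (l - f x); case: (f x) => a b; case: (l) => c d.
Qed.

Lemma cvg_Im (T : Type) (F : set_system T) {FF : Filter F} (f : T -> C) l :
  f @ F --> l -> complex.Im (f x) @[x --> F] --> complex.Im l.
Proof.
move=> /cvgcPlt fl; apply/cvgrPdist_lt => e /fl; apply: filterS => x.
by apply: le_lt_trans; have := ler_Im (l - f x); case: (f x) => a b; case: (l) => c d.
Qed.

Lemma cvgc_squeeze (T : Type) (F : set_system T) {FF : ProperFilter F}
    (f : T -> C) l (g : T -> R) :
  (\forall x \near F, normc (l - f x) <= g x) -> g @ F --> (0 : R) ->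
  f @ F --> l.
Proof.
move=> fg g0; apply/cvgcP; apply: (squeeze_cvgr _ (cvg_cst 0) g0).
by apply: filterS fg => x ->; rewrite normc_ge0.
Qed.

Lemma normc_lim_le (T : Type) (F : set_system T) {FF : ProperFilter F}
    (f : T -> C) l a (B : R) :
  f @ F --> l -> (\forall x \near F, normc (a - f x) <= B) ->
  normc (a - l) <= B.
Proof.
move=> /cvgcPlt fl fB; apply/ler_addgt0Pl => e e0.
have [x [h1 h2]] := filter_ex (filterI (fl _ e0) fB).
have -> : a - l = (a - f x) - (l - f x) by ring.
by apply: le_trans (normcB _ _) _; rewrite addrC lerD// ltW.
Qed.

Lemma nbhscP (z0 : C) (P : C -> Prop) :
  (\forall z \near z0, P z) <->
  exists2 d : R, 0 < d & forall z, normc (z - z0) < d -> P z.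
Proof.
split.
  move=> /nbhs_ballP[e /= e0 eP]; exists (complex.Re e).
    by move: e0; rewrite ltcE/= => /andP[].
  move=> z zd; apply: eP; rewrite -ball_normE/= distrC.
  have -> : e = ((complex.Re e)%:C)%C.
    by case: e e0 {zd} => a b; rewrite ltcE/= => /andP[/eqP -> _].
  by rewrite ltcP.
move=> [d d0 dP]; apply/nbhs_ballP; exists ((d%:C)%C); first by rewrite /= ltcR.
by move=> z; rewrite -ball_normE/= distrC ltcP; exact: dP.
Qed.

End Modulus.

(** * Power series and Cauchy's estimate *)

Section GeometricSeries.
Variable R : realType.
Local Notation C := R[i].

Lemma sum_geometric_le (M q : R) n m : 0 <= M -> 0 <= q < 1 ->
  \sum_(n <= k < m) M * q ^+ k <= M * q ^+ n / (1 - q).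
Proof.
move=> M0 /andP[q0 q1]; have q1' : 0 < 1 - q by rewrite subr_gt0.
have [mn|/ltnW nm] := leqP m n.
  by rewrite big_geq// divr_ge0 ?mulr_ge0 ?exprn_ge0// ltW.
rewrite ler_pdivlMr// mulrC mulr_sumr.
rewrite (eq_bigr (fun k => - (M * q ^+ k.+1 - M * q ^+ k))); last first.
  by move=> k _; rewrite exprS; ring.
by rewrite sumrN telescope_sumr// opprB lerBlDr lerDl mulr_ge0 ?exprn_ge0.
Qed.

Lemma series_tail_le (u : nat -> C) (M q : R) l n : 0 <= q < 1 ->
  (forall k, normc (u k) <= M * q ^+ k) ->
  series u @ \oo --> l -> normc (l - series u n) <= M * q ^+ n / (1 - q).
Proof.
move=> q01 uM ul; rewrite distcC; apply: (normc_lim_le ul).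
have M0 : 0 <= M by have := uM 0%N; rewrite mulr1; apply/le_trans/normc_ge0.
near=> m; rewrite distcC /series/= (big_cat_nat _ (n := n))//=; last first.
  by near: m; exact: nbhs_infty_ge.
rewrite addrAC subrr add0r (le_trans (normc_sum _ _ _))//.
apply: le_trans (sum_geometric_le n m M0 q01).
by apply: ler_sum => k _.
Unshelve. all: by end_near. Qed.

Lemma real_geometric_cvg (u : nat -> R) (M q : R) : 0 <= q < 1 ->
  (forall k, `|u k| <= M * q ^+ k) -> cvgn (series u).
Proof.
move=> /andP[q0 q1] uM; apply: normed_cvg.
have M0 : 0 <= M by have := uM 0%N; rewrite mulr1; apply: le_trans.
apply: (@series_le_cvg _ _ (geometric M q)) => //= [n|].
  by rewrite mulr_ge0 ?exprn_ge0.
by apply: is_cvg_geometric_series; rewrite ger0_norm.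
Qed.

Lemma geometric_cvg (u : nat -> C) (M q : R) : 0 <= q < 1 ->
  (forall k, normc (u k) <= M * q ^+ k) -> exists l : C, series u @ \oo --> l.
Proof.
move=> q01 uM.
have /cvg_ex[a ua] : cvgn (series (fun n => complex.Re (u n))).
  by apply: (real_geometric_cvg q01) => k; apply: le_trans (ler_Re _) (uM k).
have /cvg_ex[b ub] : cvgn (series (fun n => complex.Im (u n))).
  by apply: (real_geometric_cvg q01) => k; apply: le_trans (ler_Im _) (uM k).
exists (a +i* b)%C.
apply: (@cvgc_squeeze _ _ _ _ _ _ (fun n =>
    `|a - series (fun n => complex.Re (u n)) n| +
    `|b - series (fun n => complex.Im (u n)) n|)).
  near=> n; apply: le_trans (normc_le _) _.
  have -> : series u n = (series (fun n => complex.Re (u n)) n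
      +i* series (fun n => complex.Im (u n)) n)%C.
    rewrite /series/=; elim: (n) => [|m IH]; first by rewrite !big_geq.
    by rewrite !big_nat_recr//= IH; case: (u m).
  by [].
rewrite -[X in _ --> X]addr0; apply: cvgD; apply/norm_cvg0P.
  by rewrite -(subrr a); apply: cvgB => //; exact: cvg_cst.
by rewrite -(subrr b); apply: cvgB => //; exact: cvg_cst.
Unshelve. all: by end_near. Qed.

End GeometricSeries.

Section PowerSeries.
Variable R : realType.
Local Notation C := R[i].
Implicit Types (c : nat -> C) (f g : C -> C) (z : C) (r s : R).

(** For a function on a disc, being the sum of a single power series is stronger
    on its face than [analytic_at] at every point, and is the form in which
    Cauchy's estimate applies. *)
Definition pseries c r f := forall z, normc z < r ->
  series (fun n => c n * z ^+ n) @ \oo --> f z.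

Definition holo r f := exists c, pseries c r f.

Lemma pseries_le c r s f : s <= r -> pseries c r f -> pseries c s f.
Proof. by move=> sr cf z zs; apply: cf; exact: lt_le_trans sr. Qed.

Lemma holo_le r s f : s <= r -> holo r f -> holo s f.
Proof. by move=> sr [c cf]; exists c; exact: pseries_le cf. Qed.

Lemma eq_pseries c r f g : (forall z, normc z < r -> f z = g z) ->
  pseries c r f -> pseries c r g.
Proof. by move=> fg cf z zr; rewrite -fg//; exact: cf. Qed.

Lemma eq_holo r f g : (forall z, normc z < r -> f z = g z) ->
  holo r f -> holo r g.
Proof. by move=> fg [c cf]; exists c; exact: eq_pseries cf. Qed.

Lemma coef_bounded c r s f : pseries c r f -> 0 <= s < r ->
  exists2 M : R, 0 <= M & forall k, normc (c k) * s ^+ k <= M.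
Proof.
move=> cf /andP[s0 sr].
have /cf sf : normc ((s%:C)%C : C) < r by rewrite normc_real ger0_norm.
have /cvg_series_cvg_0/cvgcP h : cvgn (series (fun n => c n * ((s%:C)%C : C) ^+ n)).
  by apply/cvg_ex; eexists; exact: sf.
have /cvg_seq_bounded/bounded_fun_has_ubound[M hM] := @cvgP _ _ _ h.
have {}hM k : normc (c k) * s ^+ k <= M.
  rewrite -[s](ger0_norm s0) -normc_real -normcX -normcM -normcN -sub0r.
  by apply: hM; exists k.
exists M => //; apply: le_trans (hM 0%N).
by rewrite mulr_ge0 ?exprn_ge0 ?normc_ge0.
Qed.

(** The terms are dominated by the geometric sequence [M * (|z| / s) ^ k], and so
    is the remainder of the series. *)
Lemma pseries_tail c r f M s n z : pseries c r f -> 0 < s ->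
  (forall k, normc (c k) * s ^+ k <= M) -> normc z < s -> normc z < r ->
  normc (f z - series (fun n => c n * z ^+ n) n) <=
    M * (normc z / s) ^+ n / (1 - normc z / s).
Proof.
move=> cf s0 cM zs zr; apply: series_tail_le (cf z zr) => [|k].
  by rewrite divr_ge0 ?normc_ge0 ?ltW//= ltr_pdivrMr// mul1r.
rewrite normcM normcX expr_div_n mulrA ler_pdivlMr ?exprn_gt0// mulrAC.
by rewrite ler_wpM2r ?exprn_ge0 ?normc_ge0.
Qed.

Lemma pseries_approx c r s f e : pseries c r f -> 0 < s < r -> 0 < e ->
  \forall n \near \oo, forall z, normc z <= s ->
    normc (f z - series (fun n => c n * z ^+ n) n) < e.
Proof.
move=> cf /andP[s0 sr] e0; pose t := (s + r) / 2.
have [st tr] : s < t /\ t < r by rewrite /t; split; lra.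
have t0 : 0 < t by exact: lt_trans st.
have [|M M0 cM] := coef_bounded (s := t) cf; first by rewrite ltW.
have q01 : 0 <= s / t < 1 by rewrite divr_ge0 ?ltW//= ltr_pdivrMr// mul1r.
have : (fun n => M / (1 - s / t) * (s / t) ^+ n) @ \oo --> (0 : R).
  by apply: cvg_geometric; rewrite ger0_norm; case/andP: q01.
move=> /cvgrPdist_lt/(_ _ e0); apply: filterS => n.
have q1 : 0 < 1 - s / t by rewrite subr_gt0; case/andP: q01.
case/andP: q01 => q0 _; rewrite sub0r normrN ger0_norm; last first.
  by rewrite mulr_ge0 ?divr_ge0 ?exprn_ge0// ltW.
move=> h z zs; apply: le_lt_trans h.
have zt : normc z < t by exact: le_lt_trans st.
apply: le_trans (pseries_tail _ cf t0 cM zt (lt_trans zt tr)) _.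
have zst : normc z / t <= s / t by rewrite ler_pM2r ?invr_gt0.
have zt0 : 0 <= normc z / t by rewrite divr_ge0 ?normc_ge0 ?ltW.
rewrite [leRHS]mulrAC ler_pM ?mulr_ge0 ?exprn_ge0 ?invr_ge0//.
- by rewrite subr_ge0 (le_trans zst)// -subr_ge0 ltW.
- by rewrite ler_wpM2l// lerXn2r ?nnegrE.
- by rewrite lef_pV2 ?posrE// ?lerB// (lt_le_trans q1)// lerB.
Qed.

Lemma holo_bounded r s f : 0 < s < r -> holo r f ->
  exists2 B : R, 0 <= B & forall z, normc z <= s -> normc (f z) <= B.
Proof.
move=> sr [c cf]; have s0 : 0 < s by case/andP: sr.
have [n h] := filter_ex (pseries_approx cf sr ltr01).
exists (1 + \sum_(0 <= k < n) normc (c k) * s ^+ k).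
  rewrite addr_ge0// sumr_ge0// => k _.
  by rewrite mulr_ge0 ?normc_ge0// exprn_ge0 ?ltW.
move=> z zs; rewrite -[f z](subrK (series (fun n => c n * z ^+ n) n)).
apply: le_trans (normcD _ _) (lerD (ltW (h z zs)) _).
apply: le_trans (normc_sum _ _ _) _; apply: ler_sum => k _.
rewrite normcM normcX ler_wpM2l ?normc_ge0// lerXn2r ?nnegrE ?normc_ge0//.
exact: ltW.
Qed.

(** For [m <> k] this is the geometric sum of [w ^ m / w ^ k], an [N]-th root of
    unity different from [1]. *)
Lemma sum_primitive_root (N m k : nat) (w : C) : N.-primitive_root w ->
  (m < N)%N -> (k < N)%N ->
  \sum_(j < N) w ^+ (j * m) / w ^+ (j * k) = (N * (m == k))%:R.
Proof.
move=> wN mN kN; have w0 : w != 0.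
  apply/eqP => w0; have := prim_expr_order wN.
  have N0 := prim_order_gt0 wN.
  by rewrite w0 expr0n eqn0Ngt N0/= => /eqP; rewrite eq_sym oner_eq0.
have [->|mk] := eqVneq m k.
  rewrite (eq_bigr (fun=> 1)) ?muln1 ?sumr_const ?card_ord// => j _.
  by rewrite divff// expf_neq0.
rewrite muln0; pose x := w ^+ m / w ^+ k.
have x1 : x != 1.
  rewrite /x -subr_eq0 -(inj_eq (mulIf (expf_neq0 k w0))) mulrBl mul0r.
  rewrite divfK ?expf_neq0// mul1r subr_eq0 (eq_prim_root_expr wN).
  by rewrite /eqn !modn_small.
have xN : x ^+ N = 1.
  rewrite expr_div_n -!exprM ![(_ * N)%N]mulnC !exprM (prim_expr_order wN).
  by rewrite !expr1n divr1.
apply: (mulfI (x := x - 1)); first by rewrite subr_eq0.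
rewrite mulr0 (eq_bigr (fun j : 'I_N => x ^+ j)); last first.
  by move=> j _; rewrite expr_div_n -!exprM ![(j * _)%N]mulnC.
by rewrite -subrX1 xN subrr.
Qed.

(** In characteristic zero [X ^ N - 1] is separable, so an algebraically closed
    field contains [N] distinct [N]-th roots of unity. *)
Lemma exists_primitive_root N : (0 < N)%N ->
  exists w : C, N.-primitive_root w.
Proof.
move=> N0; pose p : {poly C} := 'X^N - 1.
have [r Dp] := closed_field_poly_normal p.
rewrite (monicP _) ?monicXnsubC// scale1r in Dp.
have rN1 : all N.-unity_root r.
  by apply/allP=> z; rewrite -root_prod_XsubC -Dp.
have sz_r : (N < (size r).+1)%N.
  by rewrite -(size_prod_XsubC r id) -Dp size_XnsubC.
have [|z] := hasP (has_prim_root N0 rN1 _ sz_r); last by exists z.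
by rewrite -separable_prod_XsubC -Dp separable_Xn_sub_1// pnatr_eq0 -lt0n.
Qed.

(** Cauchy's estimate. Averaging the partial sum of order [N > k] over the
    [N]-th roots of unity isolates its [k]-th coefficient. *)
Lemma cauchy_estimate c r s f B k : pseries c r f -> 0 < s < r ->
  (forall z, normc z = s -> normc (f z) <= B) -> normc (c k) * s ^+ k <= B.
Proof.
move=> cf sr fB; have s0 : 0 < s by case/andP: sr.
apply/ler_addgt0Pl => e e0.
have [N [/= kN h]] := filter_ex (filterI (nbhs_infty_gt k)
  (pseries_approx cf sr e0)).
have N0 : (0 < N)%N by exact: leq_ltn_trans kN.
have [w wN] := exists_primitive_root N0.
have nw : normc w = 1.
  apply/eqP; rewrite -(pexpr_eq1 N0 (normc_ge0 _)) -normcX.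
  by rewrite (prim_expr_order wN) normc1E.
pose z j : C := (s%:C)%C * w ^+ j.
have nz j : normc (z j) = s.
  by rewrite normcM normc_real normcX nw expr1n mulr1 ger0_norm// ltW.
have key : \sum_(j < N) series (fun n => c n * z j ^+ n) N / w ^+ (j * k) =
    N%:R * (c k * (s%:C)%C ^+ k).
  under eq_bigr => j _ do rewrite seriesEord mulr_suml.
  rewrite exchange_big/= (bigD1 (Ordinal kN))//= [X in _ + X]big1 => [|i ik].
    rewrite addr0 (eq_bigr (fun j : 'I_N => (c k * (s%:C)%C ^+ k) *
        (w ^+ (j * k) / w ^+ (j * k)))).
      by rewrite -mulr_sumr (sum_primitive_root wN)// eqxx muln1 mulrC.
    by move=> j _; rewrite exprMn -exprM !mulrA.
  rewrite (eq_bigr (fun j : 'I_N => (c i * (s%:C)%C ^+ i) *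
      (w ^+ (j * i) / w ^+ (j * k)))).
    rewrite -mulr_sumr (sum_primitive_root wN)//.
    have -> : (i == k :> nat) = false by apply/negbTE; exact: ik.
    by rewrite muln0 mulr0.
  by move=> j _; rewrite exprMn -exprM !mulrA.
have : N%:R * (normc (c k) * s ^+ k) <= N%:R * (e + B).
  have -> : N%:R * (normc (c k) * s ^+ k) =
      normc (N%:R * (c k * ((s%:C)%C : C) ^+ k)).
    by rewrite !normcM normcX normc_real normc_nat ger0_norm// ltW.
  rewrite -key; apply: le_trans (normc_sum _ _ _) _.
  rewrite mulr_natl -[X in _ *+ X]card_ord -sumr_const; apply: ler_sum => j _.
  rewrite normcM normcV normcX nw expr1n invr1 mulr1.
  rewrite -[series _ _](subKr (f (z j))).
  apply: le_trans (normcB _ _) _; rewrite addrC lerD//.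
    by apply/ltW/h; rewrite nz.
  exact/fB/nz.
by rewrite ler_pM2l// ltr0n.
Qed.

End PowerSeries.

(** * Closure properties of sums of power series *)

Section HolomorphicClass.
Variable R : realType.
Local Notation C := R[i].
Implicit Types (c d : nat -> C) (f g : C -> C) (z a : C) (r s B : R).

Lemma pseriesD c d r f g : pseries c r f -> pseries d r g ->
  pseries (fun n => c n + d n) r (fun z => f z + g z).
Proof.
move=> cf dg z zr.
have -> : series (fun n => (c n + d n) * z ^+ n) =
    series (fun n => c n * z ^+ n) \+ series (fun n => d n * z ^+ n).
  apply/funext => n; rewrite /series/= -big_split/=.
  by apply: eq_bigr => k _; rewrite mulrDl.
by apply: cvgD; [exact: cf|exact: dg].
Qed.

Lemma pseriesZ c r f a : pseries c r f ->
  pseries (fun n => a * c n) r (fun z => a * f z).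
Proof.
move=> cf z zr.
have -> : series (fun n => a * c n * z ^+ n) =
    (fun n => a * series (fun n => c n * z ^+ n) n).
  apply/funext => n; rewrite /series/= mulr_sumr.
  by apply: eq_bigr => k _; rewrite mulrA.
by apply: cvgMl_tmp; exact: cf.
Qed.

Lemma pseriesB c d r f g : pseries c r f -> pseries d r g ->
  pseries (fun n => c n - d n) r (fun z => f z - g z).
Proof.
move=> cf dg; have := pseriesD cf (pseriesZ (a := -1) dg).
rewrite (_ : (fun n => c n + -1 * d n) = (fun n => c n - d n)); last first.
  by apply/funext => n; rewrite mulN1r.
by apply: eq_pseries => z _; rewrite mulN1r.
Qed.

Lemma pseries_unique c d r f : 0 < r -> pseries c r f -> pseries d r f -> c = d.
Proof.
move=> r0 cf df; apply/funext => k; apply/eqP.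
rewrite -subr_eq0 -normc_eq0 eq_le normc_ge0 andbT.
have s0 : 0 < r / 2 by rewrite divr_gt0.
rewrite -(ler_pM2r (exprn_gt0 k s0)) mul0r.
have s1 : 0 < r / 2 < r by apply/andP; split; lra.
apply: (cauchy_estimate k (pseriesB cf df) s1) => z _.
by rewrite subrr normc0E.
Qed.

(** By uniqueness of the coefficients, the series found on the smaller discs are
    one and the same. It thus suffices to work on smaller discs, where [holo]
    functions are bounded. *)
Lemma holo_glue r f : 0 < r -> (forall s, 0 < s < r -> holo s f) -> holo r f.
Proof.
move=> r0 H; have [|c cf] := H (r / 2); first by lra.
exists c => z zr; pose s := Num.max ((normc z + r) / 2) (r / 2).
have [zs rs sr] : [/\ normc z < s, r / 2 <= s & s < r].
  rewrite /s lt_max le_max gt_max lexx orbT; split => //.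
  - by apply/orP; left; lra.
  - by apply/andP; split; lra.
have [|d df] := H s; first by lra.
suff -> : c = d by exact: df.
by apply: pseries_unique cf (pseries_le rs df); lra.
Qed.

Lemma pseries_cst a r : pseries (fun n => a * (n == 0%N)%:R) r (fun=> a).
Proof.
move=> z _; apply: cvg_near_cst; near=> n.
have n0 : (0 < n)%N by near: n; exact: nbhs_infty_gt.
apply/eqP; rewrite eq_sym; apply/eqP.
rewrite /series/= big_ltn// expr0 !mulr1 big_nat_cond big1 ?addr0// => k.
by rewrite andbT => /andP[k0 _]; rewrite gtn_eqF// mulr0 mul0r.
Unshelve. all: by end_near. Qed.

Lemma pseriesMX c r f : pseries c r f ->
  pseries (fun n => if n is k.+1 then c k else 0) r (fun z => z * f z).
Proof.
move=> cf z zr; rewrite -cvg_shiftS/=.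
have -> : (fun n => series (fun n => (if n is k.+1 then c k else 0) * z ^+ n) n.+1) =
    (fun n => z * series (fun n => c n * z ^+ n) n).
  apply/funext => n; rewrite /series/= big_nat_recl// mul0r add0r mulr_sumr.
  by apply: eq_bigr => k _; rewrite exprS mulrCA.
by apply: cvgMl_tmp; exact: cf.
Qed.

Lemma holo_cst r a : holo r (fun=> a).
Proof. by eexists; exact: pseries_cst. Qed.

Lemma holoD r f g : holo r f -> holo r g -> holo r (fun z => f z + g z).
Proof. by move=> [c cf] [d dg]; eexists; exact: pseriesD cf dg. Qed.

Lemma holoB r f g : holo r f -> holo r g -> holo r (fun z => f z - g z).
Proof. by move=> [c cf] [d dg]; eexists; exact: pseriesB cf dg. Qed.

Lemma holoZ r a f : holo r f -> holo r (fun z => a * f z).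
Proof. by move=> [c cf]; eexists; exact: pseriesZ cf. Qed.

Lemma holoMX r f : holo r f -> holo r (fun z => z * f z).
Proof. by move=> [c cf]; eexists; exact: pseriesMX cf. Qed.

Lemma holo_sum r (n : nat) (F : nat -> C -> C) :
  (forall k, holo r (F k)) -> holo r (fun z => \sum_(0 <= k < n) F k z).
Proof.
move=> HF; elim: n => [|n IH].
  apply: eq_holo (holo_cst r 0) => z _; by rewrite big_geq.
by apply: eq_holo (holoD IH (HF n)) => z _; rewrite big_nat_recr.
Qed.

Lemma holo_mulXn r f n : holo r f -> holo r (fun z => z ^+ n * f z).
Proof.
move=> hf; elim: n => [|n /holoMX].
  by apply: eq_holo hf => z _; rewrite mul1r.
by apply: eq_holo => z _; rewrite exprS mulrA.
Qed.

(** Weierstrass's theorem. Cauchy's estimate, applied to differences of uniform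
    approximants, makes their coefficients converge at a geometric rate; the
    power series formed by the limits is [f]. *)
Lemma holo_uniform_limit r f :
  (forall e : R, 0 < e -> exists2 g, holo r g &
     forall z, normc z < r -> normc (f z - g z) <= e) ->
  holo r f.
Proof.
move=> H; pose h : R := 2^-1.
have h0 n : 0 < h ^+ n by rewrite exprn_gt0// invr_gt0.
have /choice[g gP] n : exists gc : (C -> C) * (nat -> C), pseries gc.2 r gc.1 /\
    forall z, normc z < r -> normc (f z - gc.1 z) <= h ^+ n.
  by have [g [c cg] fg] := H _ (h0 n); exists (g, c).
pose c n := (g n).2.
have h01 : 0 <= h < 1 by rewrite /h; apply/andP; split; lra.
have cD n k s : 0 < s < r -> normc (c n.+1 k - c n k) * s ^+ k <= 2 * h ^+ n.
  move=> sr; apply: (cauchy_estimate k (pseriesB (gP n.+1).1 (gP n).1) sr) => z zs.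
  have zr : normc z < r by rewrite zs; case/andP: sr.
  have -> : (g n.+1).1 z - (g n).1 z =
    (f z - (g n).1 z) - (f z - (g n.+1).1 z) by ring.
  apply: le_trans (normcB _ _) _.
  have := (gP n).2 z zr; have := (gP n.+1).2 z zr; have := h0 n.
  by rewrite exprS {2}/h; lra.
have [r0|r0] := leP r 0.
  by exists (c 0%N) => z /lt_le_trans/(_ r0); rewrite ltNge normc_ge0.
pose s0 := r / 2.
have s0r : 0 < s0 < r by rewrite /s0; apply/andP; split; lra.
(* The limit of the coefficients, less the first one, as a telescoping sum. *)
have /choice[l lP] k : exists l : C,
    series (fun n => c n.+1 k - c n k) @ \oo --> l.
  apply: (geometric_cvg (M := 2 / s0 ^+ k) h01) => n.
  have sk : 0 < s0 ^+ k by rewrite exprn_gt0//; case/andP: s0r.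
  by rewrite mulrAC ler_pdivlMr//; exact: cD.
have lB k n s : 0 < s < r ->
    normc (c 0%N k + l k - c n k) * s ^+ k <= 4 * h ^+ n.
  move=> sr; have sk : 0 < s ^+ k by rewrite exprn_gt0//; case/andP: sr.
  have : normc (l k - series (fun n => c n.+1 k - c n k) n) <=
      2 / s ^+ k * h ^+ n / (1 - h).
    apply: (series_tail_le n h01 _ (lP k)) => m.
    by rewrite mulrAC ler_pdivlMr//; exact: cD.
  have -> : l k - series (fun n => c n.+1 k - c n k) n = c 0%N k + l k - c n k.
    by rewrite /series/= telescope_sumr//; ring.
  have -> : 2 / s ^+ k * h ^+ n / (1 - h) = 4 * h ^+ n / s ^+ k.
    have -> : 1 - h = h by rewrite /h; lra.
    by rewrite /h; field; rewrite lt0r_neq0.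
  by rewrite ler_pdivlMr.
exists (fun k => c 0%N k + l k) => z zr.
pose s := (normc z + r) / 2.
have z0 := normc_ge0 z.
have [sr zs] : 0 < s < r /\ normc z < s.
  by rewrite /s; split; [apply/andP; split|]; lra.
have s_gt0 : 0 < s by case/andP: sr.
pose q := normc z / s.
have q01 : 0 <= q < 1 by rewrite divr_ge0 ?z0 ?ltW//= ltr_pdivrMr// mul1r.
have q1 : 0 < 1 - q by rewrite subr_gt0; case/andP: q01.
apply/cvgcPlt => e e0.
have [n hn] : exists n, h ^+ n * (1 + 4 / (1 - q)) < e / 2.
  have : (fun n => (1 + 4 / (1 - q)) * h ^+ n) @ \oo --> (0 : R).
    by apply: cvg_geometric; rewrite ger0_norm; case/andP: h01.
  have e2 : 0 < e / 2 by rewrite divr_gt0.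
  move=> /cvgrPdist_lt/(_ _ e2)/filter_ex[n hn]; exists n.
  move: hn; rewrite sub0r normrN; rewrite mulrC; apply: le_lt_trans.
  exact: ler_norm.
have e2 : 0 < e / 2 by rewrite divr_gt0.
have /cvgcPlt/(_ _ e2) := (gP n).1 z zr.
apply: filterS => m hm.
have -> : f z - series (fun k => (c 0%N k + l k) * z ^+ k) m =
    (f z - (g n).1 z) + ((g n).1 z - series (fun k => c n k * z ^+ k) m)
    - series (fun k => (c 0%N k + l k - c n k) * z ^+ k) m.
  have -> : series (fun k => (c 0%N k + l k - c n k) * z ^+ k) m =
      series (fun k => (c 0%N k + l k) * z ^+ k) m -
      series (fun k => c n k * z ^+ k) m.
    by rewrite /series/= -sumrB; apply: eq_bigr => k _; rewrite mulrBl.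
  by ring.
have A := (gP n).2 z zr.
have Bd : normc (series (fun k => (c 0%N k + l k - c n k) * z ^+ k) m) <=
    4 * h ^+ n / (1 - q).
  apply: le_trans (normc_sum _ _ _) _.
  apply: le_trans (_ : \sum_(0 <= k < m) (4 * h ^+ n) * q ^+ k <= _); last first.
    have := @sum_geometric_le _ (4 * h ^+ n) q 0 m _ q01; rewrite expr0 mulr1.
    by apply; rewrite mulr_ge0// ltW.
  apply: ler_sum => k _; rewrite normcM normcX /q expr_div_n mulrA.
  rewrite ler_pdivlMr ?exprn_gt0// mulrAC ler_wpM2r ?exprn_ge0//.
  exact: lB.
apply: le_lt_trans (normcB _ _) _.
apply: le_lt_trans (lerD (normcD _ _) (le_refl _)) _.
move: hn; rewrite mulrDr mulr1 => hn.
have -> : e = e / 2 + e / 2 by lra.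
have E : h ^+ n * (4 / (1 - q)) = 4 * h ^+ n / (1 - q) by ring.
by rewrite E in hn; move: A hm Bd hn; rewrite /c; lra.
Qed.

Lemma holo_mul_polynomial r f c n : holo r f ->
  holo r (fun z => series (fun k => c k * z ^+ k) n * f z).
Proof.
move=> hf; have := @holo_sum r n (fun k z => c k * (z ^+ k * f z)).
move=> /(_ (fun k => holoZ (c k) (holo_mulXn k hf))).
apply: eq_holo => z _; rewrite /series/= mulr_suml.
by apply: eq_bigr => k _; rewrite mulrA.
Qed.

(** On a smaller disc [g] is bounded, and [f * g] is the uniform limit of the
    products of [g] with the partial sums of [f]. *)
Lemma holoM r f g : holo r f -> holo r g -> holo r (fun z => f z * g z).
Proof.
have [r0 _ [c _]|r0] := leP r 0.
  by exists c => z /lt_le_trans/(_ r0); rewrite ltNge normc_ge0.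
move=> [c cf] hg; apply: holo_glue => // s sr.
apply: holo_uniform_limit => e e0.
have [B B0 gB] := holo_bounded sr hg.
have B1 : 0 < B + 1 by lra.
have [n fn] := filter_ex (pseries_approx cf sr (divr_gt0 e0 B1)).
exists (fun z => series (fun k => c k * z ^+ k) n * g z).
  by apply: holo_mul_polynomial; apply: holo_le hg; case/andP: sr => _ /ltW.
move=> z /ltW zs; rewrite -mulrBl normcM.
have -> : e = e / (B + 1) * (B + 1) by rewrite divfK// gt_eqF.
apply: ler_pM; rewrite ?normc_ge0//; first exact/ltW/fn.
by apply: le_trans (gB z zs) _; lra.
Qed.

Lemma holoX r f n : holo r f -> holo r (fun z => f z ^+ n).
Proof.
move=> hf; elim: n => [|n IH]; first exact: holo_cst.
by apply: eq_holo (holoM hf IH) => z _; rewrite exprS.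
Qed.

(** The partial sums of [g] converge uniformly on the disc of radius [t], which
    contains the values of [f]; so [g (f z)] is a uniform limit of polynomials
    in [f z]. *)
Lemma holo_comp r s t f g : 0 < t < s -> holo s g -> holo r f ->
  (forall z, normc z < r -> normc (f z) <= t) -> holo r (fun z => g (f z)).
Proof.
move=> ts [c cg] hf ft; apply: holo_uniform_limit => e e0.
have [n gn] := filter_ex (pseries_approx cg ts e0).
exists (fun z => \sum_(0 <= k < n) c k * f z ^+ k); last first.
  by move=> z /ft/gn/ltW.
exact: (@holo_sum r n (fun k z => c k * f z ^+ k)
  (fun k => holoZ (c k) (holoX k hf))).
Qed.

Lemma holo_id r : holo r id.
Proof. by apply: eq_holo (holoMX (holo_cst r 1)) => z _; rewrite mulr1. Qed.

Lemma holo_geometric : holo 1 (fun z => (1 - z)^-1).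
Proof.
exists (fun=> 1) => z z1.
have z1' : 1 - z != 0.
  by rewrite subr_eq0; apply: contraTneq z1 => <-; rewrite normc1E ltxx.
have zn n : (1 - z)^-1 - series (fun n => 1 * z ^+ n) n = z ^+ n / (1 - z).
  apply: (mulIf z1'); rewrite mulrBl divfK// mulVf//.
  have -> : series (fun n => 1 * z ^+ n) n = \sum_(i < n) z ^+ i.
    by rewrite seriesEord/=; apply: eq_bigr => k _; rewrite mul1r.
  by rewrite -[1 - z]opprB mulrN opprK mulrC -subrX1; ring.
apply: (@cvgc_squeeze _ _ _ _ _ _ (fun n => (normc (1 - z))^-1 * normc z ^+ n)).
  by apply: nearW => n; rewrite zn normcM normcX normcV mulrC.
by apply: cvg_geometric; rewrite ger0_norm ?normc_ge0.
Qed.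

(** If [b <= Re f] and [|f| <= B], then [|1 - t f| < 1] for small [t > 0], so
    that [1 / f = t / (1 - (1 - t f))] is a geometric series in [1 - t f]. *)
Lemma holo_inv r f b : 0 < b -> holo r f ->
  (forall z, normc z < r -> b <= complex.Re (f z)) ->
  holo r (fun z => (f z)^-1).
Proof.
have [r0 _ [c _]|r0] := leP r 0.
  by exists c => z /lt_le_trans/(_ r0); rewrite ltNge normc_ge0.
move=> b0 hf fb; apply: holo_glue => // s sr.
have [B' B0' fB'] := holo_bounded sr hf.
have [sr1 sr2] : 0 < s /\ s < r by case/andP: sr.
pose B := B' + b.
have B0 : 0 < B by rewrite /B; lra.
have fB z : normc z < s -> normc (f z) <= B.
  by move=> /ltW/fB'/le_trans; apply; rewrite /B; lra.
pose t := b / B ^+ 2.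
have t0 : 0 < t by rewrite divr_gt0 ?exprn_gt0.
pose p z : C := 1 - (t%:C)%C * f z.
have np z : normc z < s -> normc (p z) ^+ 2 <= 1 - (b / B) ^+ 2.
  move=> zs; have := fb z (lt_trans zs sr2); have := fB z zs.
  rewrite /p normc_sqr; have := normc_sqr (f z); case: (f z) => x y /=.
  rewrite !mul0r subr0 addr0 add0r => E xB bx.
  have E1 : x ^+ 2 + y ^+ 2 <= B ^+ 2.
    by rewrite -E lerXn2r ?nnegrE ?normc_ge0//; exact: ltW.
  have -> : (1 - t * x) ^+ 2 + (- (t * y)) ^+ 2 =
    1 - 2 * (t * x) + t ^+ 2 * (x ^+ 2 + y ^+ 2) by ring.
  have E2 : t ^+ 2 * (x ^+ 2 + y ^+ 2) <= t ^+ 2 * B ^+ 2.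
    by rewrite ler_wpM2l// exprn_ge0// ltW.
  have E3 : t ^+ 2 * B ^+ 2 = (b / B) ^+ 2.
    by rewrite /t; field; rewrite gt_eqF.
  have E4 : t * b <= t * x by rewrite ler_wpM2l// ltW.
  have E5 : t * b = (b / B) ^+ 2 by rewrite /t; field; rewrite gt_eqF.
  by rewrite E3 in E2; rewrite E5 in E4; lra.
pose rho := Num.sqrt (1 - (b / B) ^+ 2).
have bB : 0 < (b / B) ^+ 2 by rewrite exprn_gt0// divr_gt0.
have rho1 : rho < 1.
  by rewrite -[ltRHS]sqrtr1 ltr_sqrt//; lra.
have rho0 : 0 <= rho by exact: sqrtr_ge0.
have hp : holo s p.
  by apply: holoB; [exact: holo_cst|apply: holoZ; apply: holo_le hf; exact: ltW].
have pr z : normc z < s -> normc (p z) <= (rho + 1) / 2.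
  move=> zs; apply: (@le_trans _ _ rho); last by lra.
  rewrite /rho -[leLHS]ger0_norm ?normc_ge0// -sqrtr_sqr ler_wsqrtr//.
  exact: np.
have := holoZ (t%:C)%C (holo_comp _ holo_geometric hp pr).
have rho_1 : 0 < (rho + 1) / 2 < 1 by apply/andP; split; lra.
move=> /(_ rho_1); apply: eq_holo => z zs.
rewrite /p opprB addrCA subrr addr0 invfM mulVKf//.
by rewrite (_ : 0 = (0%:C)%C)// (inj_eq (@complexI _)) gt_eqF.
Qed.

End HolomorphicClass.

(** * Local behaviour of analytic functions *)

Section LocalBehaviour.
Variable R : realType.
Local Notation C := R[i].
Implicit Types (c d : nat -> C) (f g : C -> C) (z a : C) (r s B M : R).

(** Recentring: polynomials in [z0 + w] are polynomials in [w], and uniform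
    limits take care of the rest. *)
Lemma holo_recenter r f z0 : normc z0 < r -> holo r f ->
  holo (r - normc z0) (fun w => f (z0 + w)).
Proof.
move=> z0r [c cf]; apply: holo_glue => [|s /andP[s0 sr]]; first by rewrite subr_gt0.
apply: holo_uniform_limit => e e0.
have tr : 0 < normc z0 + s < r.
  by have := normc_ge0 z0; move=> ?; apply/andP; split; lra.
have [n fn] := filter_ex (pseries_approx cf tr e0).
exists (fun w => \sum_(0 <= k < n) c k * (z0 + w) ^+ k).
  apply: (@holo_sum _ _ n (fun k w => c k * (z0 + w) ^+ k)) => k.
  by apply: holoZ; apply: holoX; apply: holoD; [exact: holo_cst|exact: holo_id].
by move=> w /ltW ws; apply/ltW/fn/(le_trans (normcD _ _)); rewrite lerD2l.
Qed.

Lemma analytic_atP f z0 :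
  analytic_at f z0 <-> exists2 d : R, 0 < d & holo d (fun w => f (z0 + w)).
Proof.
split=> [[a /nbhscP[d d0 h]]|[d d0 [a h]]].
  exists d => //; exists a => w wd; have := h (z0 + w).
  by rewrite addrAC subrr add0r; exact.
exists a; apply/nbhscP; exists d => // z zd.
by have := h _ zd; rewrite subrKC.
Qed.

Lemma holo_analytic r f z : normc z < r -> holo r f -> analytic_at f z.
Proof.
move=> zr hf; apply/analytic_atP; exists (r - normc z); first by rewrite subr_gt0.
exact: holo_recenter.
Qed.

Lemma pseries0 c r f : 0 < r -> pseries c r f -> c 0%N = f 0.
Proof.
move=> r0 cf; have := cf 0; rewrite normc0E => /(_ r0) /cvg_lim <- //.
apply/esym/cvg_lim => //; apply: cvg_near_cst; near=> n.
have n0 : (0 < n)%N by near: n; exact: nbhs_infty_gt.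
rewrite /series/= big_ltn// expr0 mulr1 big_nat_cond big1 ?addr0// => k.
by rewrite andbT => /andP[k0 _]; rewrite expr0n gtn_eqF// mulr0.
Unshelve. all: by end_near. Qed.

(** Cauchy's estimate on the circles of radius [s < r], in the limit [s -> r]. *)
Lemma coef_le c r f M k : 0 < r -> pseries c r f ->
  (forall z, normc z < r -> normc (f z) <= M) -> normc (c k) * r ^+ k <= M.
Proof.
move=> r0 cf fM.
have h : (fun s : R => normc (c k) * s ^+ k) @ r^'- --> normc (c k) * r ^+ k.
  apply: cvgMl_tmp; apply: cvg_at_left_filter; exact: exprn_continuous.
rewrite -(cvg_lim _ h)//; apply: limr_le; first exact: cvgP h.
near=> s; apply: (cauchy_estimate k cf).
  by apply/andP; split; near: s; [exact: nbhs_left_gt|exact: nbhs_left_lt].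
move=> z zs; apply: fM; rewrite zs; near: s; exact: nbhs_left_lt.
Unshelve. all: by end_near. Qed.

(** Cauchy's estimate on small circles kills the coefficients of index below
    [n]; those that remain are at most [M / r ^ k], and their geometric series
    starts at [(|z| / r) ^ n]. *)
Lemma holo_order_le r f M (L d : R) n : 0 < r -> 0 < d -> holo r f ->
  (forall z, normc z < r -> normc (f z) <= M) ->
  (forall z, normc z < d -> normc (f z) <= L * normc z ^+ n) ->
  forall z, normc z < r ->
    normc (f z) <= M * (normc z / r) ^+ n / (1 - normc z / r).
Proof.
move=> r0 d0 [c cf] fM fL z zr.
have c0 k : (k < n)%N -> c k = 0.
  move=> kn; apply/eqP; rewrite -normc_eq0 eq_le normc_ge0 andbT leNgt.
  apply/negP => ck0; pose m := Num.min 1 (Num.min d r).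
  have [m0 m1 md mr] : [/\ 0 < m, m <= 1, m <= d & m <= r].
    by rewrite /m lt_min ltr01 lt_min d0 r0 !ge_min !lexx !orbT.
  have H s : 0 < s < m -> normc (c k) <= L * s.
    move=> /andP[s0 sm].
    have sr : 0 < s < r by rewrite s0 (lt_le_trans sm).
    have : normc (c k) * s ^+ k <= L * s ^+ n.
      apply: (cauchy_estimate k cf sr) => w ws; rewrite -ws; apply: fL.
      by rewrite ws (lt_le_trans sm).
    have L0 : 0 <= L.
      have sd : normc ((s%:C)%C : C) < d.
        by rewrite normc_real gtr0_norm// (lt_le_trans sm).
      have := le_trans (normc_ge0 _) (fL _ sd).
      rewrite normc_real gtr0_norm// => h.
      by rewrite -(pmulr_lge0 L (exprn_gt0 n s0)).
    rewrite -(subnK kn) addnS -addSn exprD mulrA ler_pM2r ?exprn_gt0//.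
    move/le_trans; apply; rewrite ler_wpM2l// exprS ler_piMr ?(ltW s0)//.
    by rewrite exprn_ile1 ?(ltW s0)// (le_trans (ltW sm)).
  have L0 : 0 < L.
    have m2 : 0 < m / 2 < m by apply/andP; split; lra.
    have := lt_le_trans ck0 (H _ m2); rewrite pmulr_lgt0//.
    by case/andP: m2.
  pose s := Num.min (m / 2) (normc (c k) / (2 * L)).
  have s1 : 0 < s < m.
    rewrite /s lt_min gt_min !divr_gt0 ?mulr_gt0//=.
    by apply/orP; left; lra.
  have sL : s <= normc (c k) / (2 * L) by rewrite /s ge_min lexx orbT.
  have : L * s <= normc (c k) / 2.
    apply: (@le_trans _ _ (L * (normc (c k) / (2 * L)))); first by rewrite ler_pM2l.
    by rewrite le_eqVlt; apply/orP; left; apply/eqP; field; rewrite gt_eqF.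
  by have := H s s1; lra.
have := pseries_tail n cf r0 (fun k => coef_le k r0 cf fM) zr zr.
rewrite /series/= big_nat_cond big1 ?subr0// => k /andP[/andP[_ /c0 ->] _].
by rewrite mul0r.
Qed.

Lemma holo_lipschitz0 r f B : 0 < r -> holo r f ->
  (forall z, normc z < r -> normc (f z) <= B) ->
  forall z, normc z <= r / 2 -> normc (f z - f 0) <= 2 * B / r * normc z.
Proof.
move=> r0 [c cf] fB z z2.
have zr : normc z < r by lra.
have B0 : 0 <= B by apply: le_trans (fB _ zr); exact: normc_ge0.
have := pseries_tail 1 cf r0 (fun k => coef_le k r0 cf fB) zr zr.
rewrite /series/= big_nat1 expr0 mulr1 (pseries0 r0 cf) => /le_trans; apply.
have q2 : normc z / r <= 1 / 2 by rewrite ler_pdivrMr//; lra.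
have q1 : 0 < 1 - normc z / r by lra.
rewrite ler_pdivrMr//.
have -> : 2 * B / r * normc z = 2 * (B * (normc z / r)) by ring.
have : 0 <= B * (normc z / r) by rewrite !mulr_ge0 ?invr_ge0 ?normc_ge0// ltW.
by rewrite expr1; nra.
Qed.

Lemma holo_cvg r f z0 : normc z0 < r -> holo r f -> f z @[z --> z0] --> f z0.
Proof.
move=> zr hf; pose d := (r - normc z0) / 2.
have d0 : 0 < d by rewrite /d; lra.
have hg := holo_recenter zr hf.
have dr : 0 < d < r - normc z0 by rewrite /d; apply/andP; split; lra.
have [B B0 gB] := holo_bounded dr hg.
have hgd : holo d (fun w => f (z0 + w)) by apply: holo_le hg; case/andP: dr => _ /ltW.
have := holo_lipschitz0 d0 hgd (fun w wd => gB w (ltW wd)).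
rewrite addr0 => L; apply/(cvgcPlt (F := nbhs z0)) => e e0; apply/nbhscP.
pose l : R := 2 * B / d.
have l0 : 0 <= l by apply: divr_ge0; [exact: mulr_ge0|exact: ltW].
exists (Num.min (d / 2) (e / (l + 1))).
  by rewrite lt_min; apply/andP; split; apply: divr_gt0 => //; lra.
move=> z; rewrite lt_min => /andP[/ltW zd ze].
have := L _ zd; rewrite subrKC distcC => /le_lt_trans; apply.
move: ze; rewrite ltr_pdivlMr; last by lra.
by apply: le_lt_trans; have := normc_ge0 (z - z0); rewrite -/l; nra.
Qed.

Lemma pseries_factor c r f : 0 < r -> pseries c r f -> c 0%N = 0 ->
  exists g, pseries (fun n => c n.+1) r g /\
    forall z, normc z < r -> f z = z * g z.
Proof.
move=> r0 cf c0; exists (fun z => if z == 0 then c 1%N else f z / z).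
have f0 : f 0 = 0 by rewrite -(pseries0 r0 cf).
split=> z zr; last first.
  by have [->|z0] := eqVneq z 0; [rewrite mul0r|rewrite mulrC divfK].
have [->|z0] := eqVneq z 0.
  apply: cvg_near_cst; near=> n.
  have n0 : (0 < n)%N by near: n; exact: nbhs_infty_gt.
  rewrite /series/= big_ltn// expr0 mulr1 big_nat_cond big1 ?addr0// => k.
  by rewrite andbT => /andP[k0 _]; rewrite expr0n gtn_eqF// mulr0.
have -> : series (fun n => c n.+1 * z ^+ n) =
    (fun n => series (fun n => c n * z ^+ n) n.+1 / z).
  apply/funext => n; rewrite /series/= big_nat_recl// c0 mul0r add0r mulr_suml.
  by apply: eq_bigr => k _; rewrite exprS mulrCA [z * _]mulrC mulfK.
by apply: cvgMr_tmp; rewrite cvg_shiftS; exact: cf.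
Unshelve. all: by end_near. Qed.

(** As long as the constant coefficient is zero, divide by [z]; once it is not,
    continuity at the origin concludes. *)
Lemma pseries_isolated_zero m c r f : 0 < r -> pseries c r f -> c m != 0 ->
  exists2 d : R, 0 < d & forall z, 0 < normc z < d -> f z != 0.
Proof.
move=> r0; have base b h : pseries b r h -> b 0%N != 0 ->
    exists2 d : R, 0 < d & forall z, 0 < normc z < d -> h z != 0.
  move=> bh b0; have h0 : 0 < normc (h 0) by rewrite normc_gt0 -(pseries0 r0 bh).
  have zr : normc (0 : C) < r by rewrite normc0E.
  have /cvgcPlt/(_ _ h0)/nbhscP[d d0 H] := holo_cvg zr (ex_intro _ b bh).
  exists d => // z /andP[_ zd]; have := H z; rewrite subr0 => /(_ zd).
  by apply: contraTneq => ->; rewrite subr0 ltxx.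
elim: m c f => [|m IH] c f cf cm; first exact: base cf cm.
have [c0|c0] := eqVneq (c 0%N) 0; last exact: base cf c0.
have [g [cg fg]] := pseries_factor r0 cf c0.
have [d d0 h] := IH _ _ cg cm.
exists (Num.min d r); first by rewrite lt_min d0.
move=> z; rewrite lt_min => /andP[z0 /andP[zd zr]].
by rewrite fg// mulf_neq0//; [rewrite -normc_gt0|rewrite h// z0].
Qed.

Lemma analytic_isolated_zero f z0 : analytic_at f z0 ->
  exists2 d : R, 0 < d & (forall z, normc (z - z0) < d -> f z = 0) \/
    (forall z, 0 < normc (z - z0) < d -> f z != 0).
Proof.
move=> /analytic_atP[r r0 [c cf]].
have [[m cm]|c0] := pselect (exists m, c m != 0).
  have [d d0 h] := pseries_isolated_zero r0 cf cm.
  exists d => //; right => z /h; by rewrite subrKC.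
exists r => //; left => z zr.
have := cf _ zr; rewrite subrKC => /cvg_lim <- //.
apply/cvg_lim => //; apply: cvg_near_cst; apply: nearW => n.
rewrite /series/= big1// => k _.
have [->|ck] := eqVneq (c k) 0; first by rewrite mul0r.
by exfalso; apply: c0; exists k.
Qed.

Lemma analytic_atB f g z0 : analytic_at f z0 -> analytic_at g z0 ->
  analytic_at (fun z => f z - g z) z0.
Proof.
move=> /analytic_atP[r r0 hf] /analytic_atP[s s0 hg]; apply/analytic_atP.
exists (Num.min r s); first by rewrite lt_min r0.
by apply: holoB; [apply: holo_le hf|apply: holo_le hg]; rewrite ge_min lexx ?orbT.
Qed.

(** Along the segment from [0] to [z], the set of parameters up to which [f]
    vanishes has a supremum; zeros accumulate there, hence [f] vanishes near
    that point and the supremum is the end of the segment. *)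
Lemma analytic_identity0 f (e : R) :
  (forall z, normc z < 1 -> analytic_at f z) -> 0 < e ->
  (forall z, normc z < e -> f z = 0) -> forall z, normc z < 1 -> f z = 0.
Proof.
move=> fa e0 fe z z1.
have [->|z0] := eqVneq z 0; first by apply: fe; rewrite normc0E.
have nz : 0 < normc z by rewrite normc_gt0.
pose p (t : R) : C := (t%:C)%C * z.
have pB (s t : R) : normc (p s - p t) = `|s - t| * normc z.
  by rewrite /p -mulrBl -rmorphB normcM normc_real.
pose A := [set t : R | 0 <= t <= 1 /\ forall s, 0 <= s <= t -> f (p s) = 0].
have A0 (t : R) : 0 <= t <= 1 -> t < e -> A t.
  move=> t01 te; split=> // s /andP[s0 st]; apply: fe.
  rewrite normcM normc_real ger0_norm//.
  by apply: le_lt_trans te; apply: le_trans st; rewrite ler_piMr// ltW.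
have A1 : ubound A 1 by move=> t [/andP[]].
have supA : has_sup A.
  by split; [exists 0; apply: A0; rewrite ?lexx ?ler01|exists 1].
pose T := sup A.
have T1 : T <= 1 by apply: ge_sup => //; case: supA.
have T0 : 0 < T.
  have t0 : 0 < Num.min 1 (e / 2) by rewrite lt_min ltr01 divr_gt0.
  apply: (lt_le_trans t0); apply: ub_le_sup; first by case: supA.
  apply: A0; first by rewrite ge_min lexx ltW.
  by rewrite gt_min; apply/orP; right; lra.
have fT (s : R) : 0 <= s -> s < T -> f (p s) = 0.
  move=> s0 sT; have Ts : 0 < T - s by rewrite subr_gt0.
  have [t [_ At] st] := sup_adherent Ts supA.
  by apply: At; rewrite s0/= ltW//; move: st; rewrite subKr.
have pT : normc (p T) < 1.
  by rewrite normcM normc_real gtr0_norm//; nra.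
have [d d0 [dz|dn]] := analytic_isolated_zero (fa _ pT); last first.
  pose s := T - Num.min (T / 2) (d / 2).
  have [m0 mT md] : [/\ 0 < Num.min (T / 2) (d / 2),
      Num.min (T / 2) (d / 2) <= T / 2 & Num.min (T / 2) (d / 2) <= d / 2].
    by rewrite lt_min !divr_gt0// !ge_min !lexx orbT.
  have sd : 0 < normc (p s - p T) < d.
    have -> : normc (p s - p T) = Num.min (T / 2) (d / 2) * normc z.
      by rewrite pB distrC /s subKr gtr0_norm.
    by rewrite mulr_gt0//=; nra.
  by have := dn _ sd; rewrite fT ?eqxx//; rewrite /s; lra.
have [Tlt1|T1'] := ltP T 1; last first.
  have T1E : T = 1 by apply/eqP; rewrite eq_le T1.
  by have := dz z; rewrite /p T1E mul1r subrr normc0E; exact.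
pose t := Num.min 1 (T + d / 2).
have [Tt t1 td] : [/\ T < t, t <= 1 & t <= T + d / 2].
  by rewrite /t lt_min Tlt1 !ge_min !lexx orbT; split => //; lra.
suff /(ub_le_sup (ex_intro _ 1 A1)) : A t by rewrite leNgt Tt.
split=> [|s /andP[s0 st]]; first by rewrite t1 ltW// (lt_trans T0).
have [/fT->//|Ts] := ltP s T.
apply: dz; rewrite pB ger0_norm ?subr_ge0//.
have sT : s - T <= d / 2 by lra.
by nra.
Qed.

Lemma derive1_factor f g r : 0 < r -> holo r g ->
  (forall z, normc z < r -> f z = z * g z) -> derive1 f 0 = g 0.
Proof.
move=> r0 hg fg; rewrite /derive1; apply/cvg_lim => //.
have zr : normc (0 : C) < r by rewrite normc0E.
have gc : g h @[h --> (0 : C)^'] --> g 0.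
  exact: cvg_within_filter (holo_cvg zr hg).
apply: cvg_trans gc; apply: near_eq_cvg.
have near_r : \forall h \near (0 : C)^', normc h < r.
  by apply: nbhs_dnbhs; apply/nbhscP; exists r => // z; rewrite subr0.
near=> h; have hr : normc h < r by near: h.
have h0 : h != 0 by near: h; exact: nbhs_dnbhs_neq.
by rewrite /= addr0 !fg// mul0r subr0 /GRing.scale/= mulKf.
Unshelve. all: by end_near. Qed.

(** Schwarz's lemma: the powers [f ^ n] are bounded by [1] and have a zero of
    order [n], so that [|f z| ^ n <= |z| ^ n / (1 - |z|)] for all [n]. *)
Lemma schwarz f : holo 1 f -> (forall z, normc z < 1 -> normc (f z) <= 1) ->
  f 0 = 0 -> forall z, normc z < 1 -> normc (f z) <= normc z.
Proof.
move=> hf f1 f0 z z1; rewrite leNgt; apply/negP => zf.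
have Hn n : normc (f z) ^+ n <= normc z ^+ n / (1 - normc z).
  have d0 : 0 < 1 / 2 :> R by lra.
  have H1 w : normc w < 1 -> normc (f w ^+ n) <= 1.
    by move=> w1; rewrite normcX exprn_ile1 ?normc_ge0// f1.
  have H2 w : normc w < 1 / 2 -> normc (f w ^+ n) <= 2 ^+ n * normc w ^+ n.
    move=> w2; rewrite normcX -exprMn lerXn2r ?nnegrE ?mulr_ge0 ?normc_ge0//.
    by have := holo_lipschitz0 ltr01 hf f1 (ltW w2); rewrite f0 subr0 divr1 mulr1.
  by have := holo_order_le ltr01 d0 (holoX n hf) H1 H2 z1;
    rewrite normcX divr1 mul1r.
have fz0 : 0 < normc (f z) by apply: le_lt_trans zf; exact: normc_ge0.
pose q := normc z / normc (f z).
have q01 : `|q| < 1.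
  by rewrite ger0_norm ?divr_ge0 ?normc_ge0// ltr_pdivrMr// mul1r.
have z1' : 0 < 1 - normc z by rewrite subr_gt0.
have := @cvg_geometric _ 1 q q01 => /cvgrPdist_lt/(_ _ z1')/filter_ex[n].
rewrite /= mul1r sub0r normrN ger0_norm; last first.
  by rewrite exprn_ge0// divr_ge0 ?normc_ge0.
rewrite /q expr_div_n ltr_pdivrMr ?exprn_gt0//.
by have := Hn n; rewrite ler_pdivlMr// mulrC => /le_lt_trans h /h; rewrite ltxx.
Qed.

End LocalBehaviour.

(** * The Cauchy transform of a measure on the circle *)

Section ComplexIntegral.
Variables (R : realType) (mu : probability (borel_circle R) R).
Local Notation C := R[i].
Local Notation T := (borel_circle R).
Implicit Types (f g : T -> C) (a z : C) (B : R).

Definition bounded_measurable f :=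
  [/\ measurable_fun setT (fun x => complex.Re (f x)),
      measurable_fun setT (fun x => complex.Im (f x)) &
      exists B : R, forall x, normc (f x) <= B].

Lemma bounded_integrable (h : T -> R) : measurable_fun setT h ->
  (exists B : R, forall x, `|h x| <= B) -> mu.-integrable setT (EFin \o h).
Proof.
move=> mh [B hB]; apply: measurable_bounded_integrable => //.
  by rewrite [X in (X < _)%E]probability_setT ltry.
by exists B; split => [|M BM x _]; [exact: num_real|apply: le_trans (ltW BM)].
Qed.

Lemma integrable_Re f : bounded_measurable f ->
  mu.-integrable setT (EFin \o (fun x => complex.Re (f x))).
Proof.
move=> [mR _ [B fB]]; apply: bounded_integrable => //.
by exists B => x; apply: le_trans (ler_Re _) (fB x).
Qed.

Lemma integrable_Im f : bounded_measurable f ->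
  mu.-integrable setT (EFin \o (fun x => complex.Im (f x))).
Proof.
move=> [_ mI [B fB]]; apply: bounded_integrable => //.
by exists B => x; apply: le_trans (ler_Im _) (fB x).
Qed.

Lemma bounded_measurable_cst a : bounded_measurable (fun=> a).
Proof. by split; [exact: measurable_cst..|exists (normc a)]. Qed.

Lemma bounded_measurableD f g : bounded_measurable f -> bounded_measurable g ->
  bounded_measurable (fun x => f x + g x).
Proof.
move=> [fR fI [A fA]] [gR gI [B gB]]; split.
- have -> : (fun x => complex.Re (f x + g x)) =
    (fun x => complex.Re (f x)) \+ (fun x => complex.Re (g x)).
    by apply/funext => x /=; case: (f x) (g x) => ? ? [].
  exact: measurable_funD.
- have -> : (fun x => complex.Im (f x + g x)) =
    (fun x => complex.Im (f x)) \+ (fun x => complex.Im (g x)).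
    by apply/funext => x /=; case: (f x) (g x) => ? ? [].
  exact: measurable_funD.
- by exists (A + B) => x; apply: le_trans (normcD _ _) (lerD (fA x) (gB x)).
Qed.

Lemma bounded_measurableM f g : bounded_measurable f -> bounded_measurable g ->
  bounded_measurable (fun x => f x * g x).
Proof.
move=> [fR fI [A fA]] [gR gI [B gB]]; split.
- have -> : (fun x => complex.Re (f x * g x)) =
    (fun x => complex.Re (f x) * complex.Re (g x)) \-
    (fun x => complex.Im (f x) * complex.Im (g x)).
    by apply/funext => x /=; case: (f x) (g x) => ? ? [].
  by apply: measurable_funB; exact: measurable_funM.
- have -> : (fun x => complex.Im (f x * g x)) =
    (fun x => complex.Re (f x) * complex.Im (g x)) \+
    (fun x => complex.Im (f x) * complex.Re (g x)).
    by apply/funext => x /=; case: (f x) (g x) => ? ? [].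
  by apply: measurable_funD; exact: measurable_funM.
- exists (A * B) => x; rewrite normcM.
  by apply: ler_pM (fA x) (gB x); exact: normc_ge0.
Qed.

Lemma CintegralD f g : bounded_measurable f -> bounded_measurable g ->
  Cintegral mu (fun x => f x + g x) = Cintegral mu f + Cintegral mu g.
Proof.
move=> bf bg; rewrite /Cintegral.
have -> : (fun x => complex.Re (f x + g x)) =
  (fun x => complex.Re (f x) + complex.Re (g x)).
  by apply/funext => x /=; case: (f x) (g x) => ? ? [].
have -> : (fun x => complex.Im (f x + g x)) =
  (fun x => complex.Im (f x) + complex.Im (g x)).
  by apply/funext => x /=; case: (f x) (g x) => ? ? [].
rewrite !RintegralD//; by [exact: integrable_Re|exact: integrable_Im].
Qed.

Lemma CintegralZ a f : bounded_measurable f ->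
  Cintegral mu (fun x => a * f x) = a * Cintegral mu f.
Proof.
move=> bf; rewrite /Cintegral; have := integrable_Re bf; have := integrable_Im bf.
case: a => u v hI hR.
have hZ (k : R) (h : T -> R) : mu.-integrable setT (EFin \o h) ->
    mu.-integrable setT (EFin \o (fun x => k * h x)).
  by move=> hh; exact: (integrableZl _ _ hh).
have -> : (fun x => complex.Re ((u +i* v)%C * f x)) =
  (fun x => u * complex.Re (f x) - v * complex.Im (f x)).
  by apply/funext => x /=; case: (f x).
have -> : (fun x => complex.Im ((u +i* v)%C * f x)) =
  (fun x => u * complex.Im (f x) + v * complex.Re (f x)).
  by apply/funext => x /=; case: (f x).
by rewrite RintegralB ?RintegralD ?hZ// !RintegralZl.
Qed.

Lemma Cintegral_cst a : Cintegral mu (fun=> a) = a.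
Proof.
rewrite /Cintegral !Rintegral_cst//.
have -> : fine (mu setT) = 1 by rewrite [mu setT]probability_setT.
by case: a => u v; rewrite !mulr1.
Qed.

Lemma Cintegral_sum n (F : nat -> T -> C) :
  (forall k, bounded_measurable (F k)) ->
  bounded_measurable (fun x => \sum_(0 <= k < n) F k x) /\
  Cintegral mu (fun x => \sum_(0 <= k < n) F k x) =
    \sum_(0 <= k < n) Cintegral mu (F k).
Proof.
move=> bF; elim: n => [|n [IH1 IH2]].
  have -> : (fun x => \sum_(0 <= k < 0) F k x) = (fun=> 0).
    by apply/funext => x; rewrite big_geq.
  by rewrite Cintegral_cst big_geq//; split => //; exact: bounded_measurable_cst.
have -> : (fun x => \sum_(0 <= k < n.+1) F k x) =
    (fun x => \sum_(0 <= k < n) F k x + F n x).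
  by apply/funext => x; rewrite big_nat_recr.
by rewrite CintegralD// IH2 big_nat_recr//; split => //; exact: bounded_measurableD.
Qed.

(** Bounding the real and the imaginary part separately costs the factor [2],
    which is harmless below. *)
Lemma normc_Cintegral f B : bounded_measurable f ->
  (forall x, normc (f x) <= B) -> normc (Cintegral mu f) <= 2 * B.
Proof.
move=> bf fB.
have key (h : T -> R) : mu.-integrable setT (EFin \o h) ->
    (forall x, `|h x| <= B) -> `|\int[mu]_x h x| <= B.
  move=> ih hB; apply: le_trans (le_normr_Rintegral _ ih) _ => //.
  have -> : B = \int[mu]_x B.
    rewrite Rintegral_cst//.
    have -> : fine (mu setT) = 1 by rewrite [mu setT]probability_setT.
    by rewrite mulr1.
  apply: le_Rintegral => //.
  - exact: (integrable_norm ih).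
  - by apply: bounded_integrable; [exact: measurable_cst|exists `|B|].
apply: le_trans (normc_le _) _; rewrite /Cintegral/= mulr_natl mulr2n lerD//.
  by apply: key (integrable_Re bf) _ => x; apply: le_trans (ler_Re _) (fB x).
by apply: key (integrable_Im bf) _ => x; apply: le_trans (ler_Im _) (fB x).
Qed.

Lemma normc_circle (x : T) : normc (circle_val x) = 1.
Proof.
have : unit_circle R (circle_val x) by exact: set_valP.
by rewrite /unit_circle/= normE => -[].
Qed.

Lemma continuous_circle_measurable (h : circle R -> R) : continuous h ->
  measurable_fun (setT : set T) (h : T -> R).
Proof.
move=> /continuousP ch; apply: (measurability _ (RGenOpens.measurableE R)).
move=> _ [_ [a [b ->] <-]]; rewrite setTI; apply: sub_sigma_algebra.
exact/ch/interval_open.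
Qed.

Lemma continuous_bounded_measurable (F : C -> C) B :
  (forall w, normc w = 1 -> F w' @[w' --> w] --> F w) ->
  (forall w, normc w = 1 -> normc (F w) <= B) ->
  bounded_measurable (fun x => F (circle_val x)).
Proof.
move=> cF FB.
have cc (x : circle R) : F (circle_val y) @[y --> x] --> F (circle_val (x : T)).
  apply: (@cvg_comp _ _ _ (fun y : circle R => circle_val (y : T)) F _
    (nbhs (circle_val (x : T)))); last exact/cF/normc_circle.
  exact: initial_continuous.
split; last by exists B => x; apply: FB; exact: normc_circle.
- by apply: continuous_circle_measurable => x; exact: cvg_Re (cc x).
- by apply: continuous_circle_measurable => x; exact: cvg_Im (cc x).
Qed.

Lemma bounded_measurable_circleX n :
  bounded_measurable (fun x => circle_val x ^+ n).
Proof.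
apply: (@continuous_bounded_measurable (fun w => w ^+ n) 1) => w w1.
  apply: (@holo_cvg R 2 (fun w => w ^+ n)); first by rewrite w1; lra.
  by apply: holoX; exact: holo_id.
by rewrite normcX w1 expr1n.
Qed.

Definition cauchy_transform z := Cintegral mu (fun x => (1 - z * circle_val x)^-1).

Lemma normc_1B_ge (w : C) : 1 - normc w <= normc (1 - w).
Proof.
by rewrite lerBlDr -[leLHS](@normc1E R) -{1}(subrK w 1) normcD.
Qed.

Lemma neq0_1B (w : C) : normc w < 1 -> 1 - w != 0.
Proof.
by move=> w1; rewrite -normc_gt0; apply: lt_le_trans (normc_1B_ge w); rewrite subr_gt0.
Qed.

Lemma bounded_measurable_kernel z : normc z < 1 ->
  bounded_measurable (fun x => (1 - z * circle_val x)^-1).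
Proof.
move=> z1; apply: (@continuous_bounded_measurable
    (fun w => (1 - z * w)^-1) (1 - normc z)^-1) => w w1.
  have zw : normc (z * w) < 1 by rewrite normcM w1 mulr1.
  have w2 : normc w < 2 by rewrite w1; lra.
  have zc := holo_cvg w2 (holoZ z (@holo_id R 2)).
  have gc := holo_cvg zw (@holo_geometric R).
  exact: (@cvg_comp _ _ _ (fun w' => z * w') (fun v => (1 - v)^-1) _ _ _ zc gc).
rewrite normcV lef_pV2 ?posrE ?subr_gt0//; last first.
  by rewrite normc_gt0 neq0_1B// normcM w1 mulr1.
by have := normc_1B_ge (z * w); rewrite normcM w1 mulr1.
Qed.

(** The moments of [mu] are the Taylor coefficients: the remainder of the
    geometric series of the kernel is small uniformly on the circle. *)
Lemma cauchy_transform_pseries :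
  pseries (fun n => Cintegral mu (fun x => circle_val x ^+ n)) 1 cauchy_transform.
Proof.
move=> z z1; have z1' : 0 < 1 - normc z by rewrite subr_gt0.
have E n : cauchy_transform z -
    series (fun n => Cintegral mu (fun x => circle_val x ^+ n) * z ^+ n) n =
    Cintegral mu (fun x => z ^+ n *
      (circle_val x ^+ n * (1 - z * circle_val x)^-1)).
  apply/eqP; rewrite subr_eq; apply/eqP.
  have bX k : bounded_measurable (fun x => z ^+ k * circle_val x ^+ k).
    apply: bounded_measurableM (bounded_measurable_circleX k).
    exact: bounded_measurable_cst.
  have [bS SE] := Cintegral_sum n bX.
  have -> : series (fun n => Cintegral mu (fun x => circle_val x ^+ n) * z ^+ n) n =
      Cintegral mu (fun x => \sum_(0 <= k < n) z ^+ k * circle_val x ^+ k).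
    rewrite SE /series/=; apply: eq_bigr => k _.
    rewrite mulrC; apply/esym/CintegralZ; exact: bounded_measurable_circleX.
  rewrite -CintegralD//; last first.
    apply: bounded_measurableM (bounded_measurable_cst _) _.
    apply: bounded_measurableM (bounded_measurable_circleX n) _.
    exact: bounded_measurable_kernel.
  congr (Cintegral mu _); apply/funext => x.
  have zx : 1 - z * circle_val x != 0.
    by rewrite neq0_1B// normcM normc_circle mulr1.
  rewrite mulrA -exprMn (eq_bigr (fun k => (z * circle_val x) ^+ k)); last first.
    by move=> k _; rewrite exprMn.
  apply: (mulIf zx); rewrite mulrDl mulVf// divfK// big_mkord.
  move: (z * circle_val x) => y.
  by rewrite -[1 - y]opprB mulrN mulrC -subrX1; ring.
apply: (@cvgc_squeeze _ _ _ _ _ _ (fun n => 2 / (1 - normc z) * normc z ^+ n)).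
  apply: nearW => n; rewrite E CintegralZ; last first.
    apply: bounded_measurableM (bounded_measurable_circleX n) _.
    exact: bounded_measurable_kernel.
  rewrite normcM normcX mulrC ler_wpM2r ?exprn_ge0 ?normc_ge0//.
  apply: normc_Cintegral => [|x].
    apply: bounded_measurableM (bounded_measurable_circleX n) _.
    exact: bounded_measurable_kernel.
  rewrite normcM normcX normc_circle expr1n mul1r normcV.
  have := normc_1B_ge (z * circle_val x).
  rewrite normcM normc_circle mulr1 => h.
  by rewrite lef_pV2 ?posrE// (lt_le_trans z1').
by apply: cvg_geometric; rewrite ger0_norm ?normc_ge0.
Qed.

Lemma psi_cauchy_transform z : normc z < 1 -> 1 + psi mu z = cauchy_transform z.
Proof.
move=> z1.
rewrite /psi -[X in X + _]Cintegral_cst -CintegralD.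
- congr (Cintegral mu _); apply/funext => x.
  have zx : 1 - z * circle_val x != 0.
    by rewrite neq0_1B// normcM normc_circle mulr1.
  by apply: (mulIf zx); rewrite mulrDl divfK// mulVf// mul1r subrK.
- exact: bounded_measurable_cst.
apply: bounded_measurableM (bounded_measurable_kernel z1).
apply: bounded_measurableM (bounded_measurable_cst _) _.
exact: (bounded_measurable_circleX 1).
Qed.

(** The kernel already has real part at least [1 / 2], because
    [w |-> 1 / (1 - w)] sends the unit disc into that half-plane. *)
Lemma Re_cauchy_transform z : normc z < 1 ->
  1 / 2 <= complex.Re (cauchy_transform z).
Proof.
move=> z1; have -> : (1 / 2 : R) = \int[mu]_x (1 / 2).
  rewrite Rintegral_cst//.
  have -> : fine (mu setT) = 1 by rewrite [mu setT]probability_setT.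
  by rewrite mulr1.
apply: le_Rintegral => //.
- by apply: bounded_integrable; [exact: measurable_cst|exists `|1 / 2|].
- exact/integrable_Re/bounded_measurable_kernel.
move=> x _; have : normc (z * circle_val x) < 1.
  by rewrite normcM normc_circle mulr1.
have := normc_sqr (z * circle_val x); have := normc_ge0 (z * circle_val x).
case: (z * _) => u v /=; rewrite sub0r sqrrN => n0 E n1.
have uv : u ^+ 2 + v ^+ 2 < 1.
  by rewrite -E expr_lt1.
have d0 : 0 < (1 - u) ^+ 2 + v ^+ 2.
  have : u < 1 by nra.
  by have := sqr_ge0 v; nra.
by rewrite ler_pdivlMr//; nra.
Qed.

End ComplexIntegral.

(** * The Schur function of a measure and its quotient by the variable *)

Section SchurFactor.
Variables (R : realType) (mu : probability (borel_circle R) R).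
Local Notation C := R[i].
Local Notation G := (cauchy_transform mu).

Lemma cauchy_transform_neq0 z : normc z < 1 -> G z != 0.
Proof.
move=> z1; apply/eqP => Gz; have := Re_cauchy_transform mu z1.
by rewrite Gz /=; lra.
Qed.

Lemma QfunE z : normc z < 1 -> Qfun mu z = 1 - (G z)^-1.
Proof.
move=> z1; rewrite /Qfun psi_cauchy_transform//.
have -> : psi mu z = G z - 1 by rewrite -psi_cauchy_transform// addrAC subrr add0r.
by rewrite mulrBl divff ?cauchy_transform_neq0// mul1r.
Qed.

Lemma holo_cauchy_transform : holo 1 G.
Proof. by eexists; exact: cauchy_transform_pseries. Qed.

Lemma holo_cauchy_transformV : holo 1 (fun z => (G z)^-1).
Proof.
have h2 : 0 < 1 / 2 :> R by lra.
exact: (holo_inv h2 holo_cauchy_transform (Re_cauchy_transform mu)).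
Qed.

Lemma holo_Qfun : holo 1 (Qfun mu).
Proof.
apply: eq_holo (holoB (holo_cst 1 1) holo_cauchy_transformV) => z z1.
by rewrite QfunE.
Qed.

(** [Qfun mu = (G - 1) / G], and [Re G >= 1 / 2] says that [G] is at least as
    close to [1] as to [0]. *)
Lemma Qfun_le1 z : normc z < 1 -> normc (Qfun mu z) <= 1.
Proof.
move=> z1; have G0 := cauchy_transform_neq0 z1.
have -> : Qfun mu z = (G z - 1) / G z by rewrite QfunE// mulrBl divff// mul1r.
rewrite normcM normcV ler_pdivrMr ?normc_gt0// mul1r.
rewrite -(@ler_pXn2r _ 2) ?nnegrE ?normc_ge0// !normc_sqr.
have := Re_cauchy_transform mu z1; case: (G z) => u v /=.
by rewrite oppr0 addr0; nra.
Qed.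

Lemma cauchy_transform0 : G 0 = 1.
Proof.
rewrite /cauchy_transform -[RHS](Cintegral_cst mu 1); congr (Cintegral mu _).
by apply/funext => x; rewrite mul0r subr0 invr1.
Qed.

(** With [G - 1 = z P], the quotient is [K = P / G], and [P 0] is the first
    moment of [mu]. Schwarz's lemma bounds [K] off the origin; at the origin the
    bound follows from Cauchy's estimate on a circle around it. *)
Lemma Qfun_factor : nonzero_mean mu ->
  exists K : C -> C, [/\ holo 1 K, forall z, normc z < 1 -> normc (K z) <= 1,
    forall z, normc z < 1 -> Qfun mu z = z * K z & K 0 != 0].
Proof.
move=> m0.
have PG := pseriesB (@cauchy_transform_pseries R mu) (@pseries_cst R 1 1).
have [|P [cP PE]] := pseries_factor ltr01 PG.
  have := pseries0 ltr01 PG; rewrite cauchy_transform0 subrr; exact.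
pose K z := P z * (G z)^-1.
have QK z : normc z < 1 -> Qfun mu z = z * K z.
  move=> z1; rewrite /K mulrA -PE// QfunE// mulrBl divff ?mul1r//.
  exact: cauchy_transform_neq0.
have hK : holo 1 K by apply: holoM holo_cauchy_transformV; exists (fun n =>
  Cintegral mu (fun x => circle_val x ^+ n.+1) - 1 * (n.+1 == 0%N)%:R).
have K1 z : z != 0 -> normc z < 1 -> normc (K z) <= 1.
  move=> z0 z1; have Q0 : Qfun mu 0 = 0 by rewrite QK ?mul0r// normc0E ltr01.
  have := schwarz holo_Qfun Qfun_le1 Q0 z1.
  by rewrite QK// normcM ger_pMr ?normc_gt0.
exists K; split=> // [z z1|].
  have [->|z0] := eqVneq z 0; last exact: K1.
  have [c cK] := hK; rewrite -(pseries0 ltr01 cK) -[leLHS]mulr1 -(expr0 (1 / 2)).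
  apply: (cauchy_estimate 0 cK) => [|w w2]; first by apply/andP; split; lra.
  by apply: K1; rewrite -?normc_gt0 w2; lra.
rewrite /K cauchy_transform0 invr1 mulr1 -(pseries0 ltr01 cP) mulr0 subr0.
have -> : (fun x : borel_circle R => circle_val x ^+ 1) = (fun x => circle_val x).
  by apply/funext => x; rewrite expr1.
exact: m0.
Qed.

End SchurFactor.

(** * The fixed point of the composed Schur functions *)

Section FixedPoint.
Variable R : realType.
Local Notation C := R[i].
Implicit Types (f K : C -> C) (z a b : C).

Lemma holo_comp_disc K f : holo 1 K -> holo 1 f ->
  (forall z, normc z < 1 -> normc (f z) <= normc z) -> holo 1 (fun z => K (f z)).
Proof.
move=> hK hf fz; apply: holo_glue => // s /andP[s0 s1].
apply: (holo_comp (t := s) _ hK); first by rewrite s0.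
  exact: holo_le (ltW s1) hf.
by move=> z zs; apply: le_trans (fz _ (lt_trans zs s1)) (ltW zs).
Qed.

(** Recentred at [b], the function [K] is bounded by [1] on a disc of radius
    [1 / 2], and [a - b] lies in the disc of half that radius. *)
Lemma schur_lipschitz K a b : holo 1 K ->
  (forall z, normc z < 1 -> normc (K z) <= 1) ->
  normc a < 1 / 8 -> normc b < 1 / 8 -> normc (K a - K b) <= 4 * normc (a - b).
Proof.
move=> hK K1 a8 b8; have b1 : normc b < 1 by lra.
have h2 : 0 < 1 / 2 :> R by lra.
have hb : holo (1 / 2) (fun w => K (b + w)).
  by apply: holo_le (holo_recenter b1 hK); lra.
have Kb w : normc w < 1 / 2 -> normc (K (b + w)) <= 1.
  by move=> w2; apply: K1; apply: le_lt_trans (normcD _ _) _; lra.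
have := holo_lipschitz0 h2 hb Kb (z := a - b).
rewrite subrKC addr0 => /(_ _)/le_trans; apply.
  by apply: le_trans (normcB _ _) _; lra.
by rewrite le_eqVlt; apply/orP; left; apply/eqP; field.
Qed.

Variables K1 K2 : C -> C.
Hypotheses (hK1 : holo 1 K1) (hK2 : holo 1 K2).
Hypotheses (bK1 : forall z, normc z < 1 -> normc (K1 z) <= 1)
  (bK2 : forall z, normc z < 1 -> normc (K2 z) <= 1).

Let phi z w := z * K2 (z * K1 w).
Let F n z := iter n (phi z) 0.

Lemma contract_le K z w : (forall z, normc z < 1 -> normc (K z) <= 1) ->
  normc w < 1 -> normc (z * K w) <= normc z.
Proof.
by move=> bK w1; rewrite normcM ler_piMr ?normc_ge0// bK.
Qed.

Lemma phi_le z w : normc z < 1 -> normc w <= normc z ->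
  normc (z * K1 w) <= normc z /\ normc (phi z w) <= normc z.
Proof.
move=> z1 wz; have A := contract_le z bK1 (le_lt_trans wz z1).
by split => //; apply: contract_le bK2 (le_lt_trans A z1).
Qed.

Lemma iterate_le n z : normc z < 1 -> normc (F n z) <= normc z.
Proof.
move=> z1; elim: n => [|n IH]; first by rewrite normc0E normc_ge0.
by have [] := phi_le z1 IH.
Qed.

Lemma holo_iterate n : holo 1 (F n).
Proof.
elim: n => [|n IH]; first exact: holo_cst.
have h1 := holoMX (holo_comp_disc hK1 IH (iterate_le n)).
have b1 z : normc z < 1 -> normc (z * K1 (F n z)) <= normc z.
  by move=> z1; have [] := phi_le z1 (iterate_le n z1).
exact: holoMX (holo_comp_disc hK2 h1 b1).
Qed.

Lemma phi_lipschitz z w w' : normc z < 1 / 8 -> normc w <= normc z ->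
  normc w' <= normc z ->
  normc (phi z w - phi z w') <= 16 * normc z * normc z * normc (w - w').
Proof.
move=> z8 wz wz'; have z1 : normc z < 1 by lra.
have [A _] := phi_le z1 wz; have [A' _] := phi_le z1 wz'.
rewrite /phi -mulrBr normcM.
have := schur_lipschitz hK2 bK2 (le_lt_trans A z8) (le_lt_trans A' z8).
rewrite -mulrBr normcM.
have := schur_lipschitz hK1 bK1 (le_lt_trans wz z8) (le_lt_trans wz' z8).
have := normc_ge0 z.
move: (normc z) (normc (K1 w - K1 w')) (normc (K2 _ - K2 _)) (normc (w - w')).
move=> x p q d x0 pd qp.
have -> : 16 * x * x * d = x * (4 * (x * (4 * d))) by ring.
by rewrite ler_wpM2l// (le_trans qp)// ler_wpM2l// ler_wpM2l.
Qed.

(** The contraction factor [16 |z| ^ 2] near the origin makes the difference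
    of successive iterates vanish there to an order that grows with [n]. *)
Lemma iterate_order n z : normc z < 1 / 8 ->
  normc (F n.+1 z - F n z) <= 16 ^+ n * normc z ^+ n.
Proof.
move=> z8; have z1 : normc z < 1 by lra.
have z0 := normc_ge0 z.
elim: n => [|n IH].
  rewrite subr0 !expr0 mulr1.
  by apply: le_trans (iterate_le 1 z1) _; lra.
have := phi_lipschitz z8 (iterate_le n.+1 z1) (iterate_le n z1).
move=> /le_trans; apply.
have -> : 16 ^+ n.+1 * normc z ^+ n.+1 =
  16 * normc z * 1 * (16 ^+ n * normc z ^+ n) by rewrite !exprS; ring.
apply: ler_pM => //; rewrite ?normc_ge0 ?mulr_ge0//.
by rewrite ler_wpM2l ?mulr_ge0// ltW.
Qed.

(** The order of vanishing at the origin turns the trivial bound [2] into a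
    geometric rate valid on the whole disc, where the map need not contract. *)
Lemma iterate_geometric n z : normc z < 1 ->
  normc (F n.+1 z - F n z) <= 2 / (1 - normc z) * normc z ^+ n.
Proof.
move=> z1; have d0 : 0 < 1 / 8 :> R by lra.
have bound w : normc w < 1 -> normc (F n.+1 w - F n w) <= 2.
  move=> w1; apply: le_trans (normcB _ _) _.
  by have := iterate_le n.+1 w1; have := iterate_le n w1; lra.
have := holo_order_le ltr01 d0 (holoB (holo_iterate n.+1) (holo_iterate n))
  bound (iterate_order n) z1.
by rewrite divr1 mulrAC.
Qed.

Lemma fixed_point_holo : exists Z : C -> C,
  [/\ holo 1 Z, forall z, normc z < 1 -> normc (Z z) <= normc z &
      forall z, normc z < 1 -> Z z = z * K2 (z * K1 (Z z))].
Proof.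
have SF z n : series (fun n => F n.+1 z - F n z) n = F n z.
  by rewrite /series/= telescope_sumr// subr0.
have /choice[Z ZP] z : exists l : C, normc z < 1 -> F ^~ z @ \oo --> l.
  have [z1|] := ltP (normc z) 1; last by move=> _; exists 0.
  have q01 : 0 <= normc z < 1 by rewrite normc_ge0.
  have [l hl] := geometric_cvg q01 (fun n => iterate_geometric n z1).
  exists l => _; apply: cvg_trans hl; apply: near_eq_cvg.
  by apply: nearW => n; rewrite SF.
have Ztail z n : normc z < 1 ->
    normc (Z z - F n z) <= 2 / (1 - normc z) * normc z ^+ n / (1 - normc z).
  move=> z1; rewrite -SF; have q01 : 0 <= normc z < 1 by rewrite normc_ge0.
  apply: (series_tail_le n q01 (fun n => iterate_geometric n z1)).
  apply: cvg_trans (ZP z z1); apply: near_eq_cvg.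
  by apply: nearW => m; rewrite SF.
have Zz z : normc z < 1 -> normc (Z z) <= normc z.
  move=> z1; rewrite -normcN -sub0r; apply: (normc_lim_le (ZP z z1)).
  by apply: nearW => n; rewrite sub0r normcN; exact: iterate_le.
exists Z; split; [|exact: Zz|move=> z z1].
  apply: (holo_glue ltr01) => s /andP[s0 s1]; apply: holo_uniform_limit => e e0.
  have s1' : 0 < 1 - s by rewrite subr_gt0.
  have : (fun n => 2 / (1 - s) / (1 - s) * s ^+ n) @ \oo --> (0 : R).
    by apply: cvg_geometric; rewrite ger0_norm// ltW.
  move=> /cvgrPdist_lt/(_ _ e0)/filter_ex[n]; rewrite sub0r normrN => ne.
  exists (F n); first exact: holo_le (ltW s1) (holo_iterate n).
  move=> z zs; apply: le_trans (Ztail z n (lt_trans zs s1)) _.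
  apply: le_trans (ltW (le_lt_trans (ler_norm _) ne)).
  have sz : (1 - normc z)^-1 <= (1 - s)^-1.
    by rewrite lef_pV2 ?posrE ?subr_gt0 ?(lt_trans zs)//; lra.
  have z0 : 0 <= (1 - normc z)^-1.
    by rewrite invr_ge0 subr_ge0 ltW// (lt_trans zs).
  rewrite [leRHS]mulrAC.
  have zn : normc z ^+ n <= s ^+ n.
    by rewrite lerXn2r ?nnegrE ?normc_ge0 ?ltW.
  apply: ler_pM => //; first by rewrite !mulr_ge0 ?exprn_ge0 ?normc_ge0.
  apply: ler_pM => //; first by rewrite mulr_ge0.
    by rewrite exprn_ge0 ?normc_ge0.
  by rewrite ler_wpM2l.
have [A _] := phi_le z1 (Zz z z1).
have K1c : K1 (F n z) @[n --> \oo] --> K1 (Z z).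
  have Kc := holo_cvg (le_lt_trans (Zz z z1) z1) hK1.
  exact: (@cvg_comp _ _ _ (F ^~ z) K1 _ _ _ (ZP z z1) Kc).
have K2c : K2 (z * K1 (F n z)) @[n --> \oo] --> K2 (z * K1 (Z z)).
  have B : z * K1 (F n z) @[n --> \oo] --> z * K1 (Z z) by exact: cvgMl_tmp.
  have Kc := holo_cvg (le_lt_trans A z1) hK2.
  exact: (@cvg_comp _ _ _ (fun n => z * K1 (F n z)) K2 _ _ _ B Kc).
have FS : F n.+1 z @[n --> \oo] --> z * K2 (z * K1 (Z z)) by exact: cvgMl_tmp.
have FS' : F n.+1 z @[n --> \oo] --> Z z.
  by rewrite (cvg_shiftS (fun n => F n z)); exact: ZP.
exact: (cvg_unique (@norm_hausdorff _ _) FS' FS).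
Qed.

End FixedPoint.

(** * Solutions of the system *)

Section Solutions.
Variable R : realType.
Local Notation C := R[i].
Implicit Types (f g K Z W : C -> C) (z : C).

Lemma schur_classP f : schur_class f <->
  (forall z, normc z < 1 -> analytic_at f z) /\
  (forall z, normc z < 1 -> normc (f z) <= 1).
Proof.
split=> -[fa f1]; split=> z.
- by move=> z1; apply: fa; rewrite unit_discE.
- by move=> z1; have := f1 z; rewrite unit_discE normE => /(_ z1); rewrite lecR.
- by rewrite unit_discE => z1; exact: fa.
- by rewrite unit_discE normE => z1; rewrite lecR f1.
Qed.

Lemma schur_class_star_holo f g : holo 1 f -> holo 1 g ->
  (forall z, normc z < 1 -> f z = z * g z) -> g 0 != 0 ->
  (forall z, normc z < 1 -> normc (f z) <= normc z) -> schur_class_star f.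
Proof.
move=> hf hg fg g0 fz; split.
- apply/schur_classP; split=> z z1; first exact: holo_analytic z1 hf.
  exact: le_trans (fz z z1) (ltW z1).
- by rewrite fg ?mul0r// normc0E.
- by rewrite (derive1_factor ltr01 hg fg).
Qed.

(** Zeros of an analytic function are isolated unless it vanishes identically
    nearby, which the nonzero derivative excludes. *)
Lemma schur_class_star_punctured W : schur_class_star W ->
  exists2 d : R, 0 < d & forall z, 0 < normc z < d -> W z != 0.
Proof.
move=> [/schur_classP[Wa _] W0 dW].
have [|d d0 [Wz|Wn]] := @analytic_isolated_zero R W 0.
- by apply: Wa; rewrite normc0E.
- case/eqP: dW; apply: (derive1_factor d0 (holo_cst d 0)) => z zd.
  by rewrite mulr0 Wz// subr0.
- by exists d => // z; have := Wn z; rewrite subr0.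
Qed.

Lemma schur_class_star_small W (e : R) : schur_class_star W -> 0 < e ->
  exists2 d : R, 0 < d & forall z, normc z < d -> normc (W z) < e.
Proof.
move=> [/schur_classP[Wa _] W0 _] e0.
have z1 : normc (0 : C) < 1 by rewrite normc0E.
have /analytic_atP[r r0 hW] := Wa 0 z1.
have zr : normc (0 : C) < r by rewrite normc0E.
have /cvgcPlt/(_ _ e0)/nbhscP[d d0 h] := holo_cvg zr hW.
exists d => // z zd; have := h z; rewrite subr0 => /(_ zd).
by rewrite !add0r W0 sub0r normcN.
Qed.

Definition subordination_equations (mu1 mu2 : probability (borel_circle R) R)
    (Z1 Z2 : C -> C) := forall z, unit_disc R z ->
  Z1 z * Z2 z = z * Qfun mu1 (Z1 z) /\ Qfun mu1 (Z1 z) = Qfun mu2 (Z2 z).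

(** Near the origin, [Qfun mu1 (W1 z)] is [W1 z * K1 (W1 z)], and the factor
    [W1 z] can be cancelled because it does not vanish off the origin; the same
    holds for [W2]. *)
Lemma local_fixed_point mu1 mu2 K1 K2 W1 W2 (e : R) : 0 < e < 1 ->
  (forall z, normc z < 1 -> Qfun mu1 z = z * K1 z) ->
  (forall z, normc z < 1 -> Qfun mu2 z = z * K2 z) ->
  schur_class_star W1 -> schur_class_star W2 ->
  subordination_equations mu1 mu2 W1 W2 ->
  exists2 d : R, 0 < d <= e & forall z, normc z < d ->
    [/\ W2 z = z * K1 (W1 z), W1 z = z * K2 (W2 z),
        normc (W1 z) < e & normc (W2 z) < e].
Proof.
move=> /andP[e0 e1] QK1 QK2 sW1 sW2 eqW.
have [p1 p10 P1] := schur_class_star_punctured sW1.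
have [p2 p20 P2] := schur_class_star_punctured sW2.
have [q1 q10 S1] := schur_class_star_small sW1 e0.
have [q2 q20 S2] := schur_class_star_small sW2 e0.
have [_ W10 _] := sW1; have [_ W20 _] := sW2.
exists (Num.min e (Num.min (Num.min p1 p2) (Num.min q1 q2))).
  by rewrite !lt_min e0 p10 p20 q10 q20 ge_min lexx.
move=> z; rewrite !lt_min.
move=> /and3P[ze /andP[zp1 zp2] /andP[zq1 zq2]].
have [w1 w2] := (S1 z zq1, S2 z zq2).
have zD : unit_disc R z by rewrite unit_discE (lt_trans ze).
have [z0|z0] := eqVneq z 0.
  by rewrite z0 !mul0r W10 W20 normc0E.
have z00 : 0 < normc z by rewrite normc_gt0.
have := eqW z zD.
rewrite (QK1 _ (lt_trans w1 e1)) (QK2 _ (lt_trans w2 e1)) => -[E1 E2].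
split=> //.
- have W1z : W1 z != 0 by apply: P1; rewrite z00.
  by apply: (mulfI W1z); rewrite E1 mulrCA.
- have W2z : W2 z != 0 by apply: P2; rewrite z00.
  by apply: (mulfI W2z); rewrite mulrC E1 E2 mulrCA.
Qed.

Lemma analytic_identity f g (e : R) : 0 < e ->
  (forall z, normc z < 1 -> analytic_at f z) ->
  (forall z, normc z < 1 -> analytic_at g z) ->
  (forall z, normc z < e -> f z = g z) -> forall z, normc z < 1 -> f z = g z.
Proof.
move=> e0 fa ga fg z z1; apply/eqP; rewrite -subr_eq0; apply/eqP.
have ha w : normc w < 1 -> analytic_at (fun z => f z - g z) w.
  by move=> w1; exact: analytic_atB (fa w w1) (ga w w1).
have h0 w : normc w < e -> f w - g w = 0 by move=> we; rewrite fg ?subrr.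
exact: analytic_identity0 ha e0 h0 _ z1.
Qed.

(** Both [Z] and [W] solve the fixed-point equations near [0]. Each component is
    Lipschitz in the other with constant [4 |z| < 1], hence they agree there. *)
Lemma subordination_unique mu1 mu2 Z1 Z2 W1 W2 :
  nonzero_mean mu1 -> nonzero_mean mu2 ->
  schur_class_star Z1 -> schur_class_star Z2 ->
  subordination_equations mu1 mu2 Z1 Z2 ->
  schur_class_star W1 -> schur_class_star W2 ->
  subordination_equations mu1 mu2 W1 W2 ->
  forall z, unit_disc R z -> W1 z = Z1 z /\ W2 z = Z2 z.
Proof.
move=> m1 m2 sZ1 sZ2 eqZ sW1 sW2 eqW.
have [K1 [hK1 bK1 QK1 _]] := Qfun_factor m1.
have [K2 [hK2 bK2 QK2 _]] := Qfun_factor m2.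
have e8 : 0 < (1 / 8 : R) < 1 by apply/andP; split; lra.
have := local_fixed_point e8 QK1 QK2 sZ1 sZ2 eqZ => -[d /andP[d0 de] FZ].
have [d' /andP[d0' _] FW] := local_fixed_point e8 QK1 QK2 sW1 sW2 eqW.
pose r := Num.min d d'.
have r0 : 0 < r by rewrite lt_min d0.
have E1 z : normc z < r -> W1 z = Z1 z.
  rewrite lt_min => /andP[zd zd'].
  have [Z2E Z1E z18 z28] := FZ z zd; have [W2E W1E w18 w28] := FW z zd'.
  apply/eqP; rewrite -subr_eq0 -normc_eq0.
  have := schur_lipschitz hK2 bK2 w28 z28.
  have := schur_lipschitz hK1 bK1 w18 z18.
  have : normc (W1 z - Z1 z) = normc z * normc (K2 (W2 z) - K2 (Z2 z)).
    by rewrite W1E Z1E -mulrBr normcM.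
  have : normc (W2 z - Z2 z) = normc z * normc (K1 (W1 z) - K1 (Z1 z)).
    by rewrite W2E Z2E -mulrBr normcM.
  have z8 : normc z < 1 / 8 by apply: lt_le_trans de.
  have := normc_ge0 z; have := normc_ge0 (W1 z - Z1 z).
  have := normc_ge0 (K1 (W1 z) - K1 (Z1 z)).
  have := normc_ge0 (K2 (W2 z) - K2 (Z2 z)).
  move: (normc z) z8 (normc (W1 z - Z1 z)) (normc (W2 z - Z2 z))
    (normc (K1 _ - _)) (normc (K2 _ - _)) => x x8 a b p q q0 p0 a0 x0 bE aE pa qb.
  by rewrite eq_le a0 andbT; nra.
have E2 z : normc z < r -> W2 z = Z2 z.
  move=> zr; have := E1 z zr; move: zr; rewrite lt_min => /andP[zd zd'].
  have [Z2E _ _ _] := FZ z zd; have [W2E _ _ _] := FW z zd'.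
  by rewrite Z2E W2E => ->.
have [/schur_classP[Z1a _] _ _] := sZ1; have [/schur_classP[Z2a _] _ _] := sZ2.
have [/schur_classP[W1a _] _ _] := sW1; have [/schur_classP[W2a _] _ _] := sW2.
move=> z; rewrite unit_discE => z1.
split; first exact: (analytic_identity r0 W1a Z1a E1).
exact: (analytic_identity r0 W2a Z2a E2).
Qed.

Lemma subordination_exists mu1 mu2 : nonzero_mean mu1 -> nonzero_mean mu2 ->
  exists Z1 Z2 : C -> C, [/\ schur_class_star Z1, schur_class_star Z2 &
    subordination_equations mu1 mu2 Z1 Z2].
Proof.
move=> m1 m2.
have [K1 [hK1 bK1 QK1 K10]] := Qfun_factor m1.
have [K2 [hK2 bK2 QK2 K20]] := Qfun_factor m2.
have [Z1 [hZ1 bZ1 Z1E]] := fixed_point_holo hK1 hK2 bK1 bK2.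
have z1 : normc (0 : C) < 1 by rewrite normc0E.
have Z10 : Z1 0 = 0 by rewrite Z1E// mul0r.
pose Z2 z := z * K1 (Z1 z).
have hZ2 : holo 1 Z2 := holoMX (holo_comp_disc hK1 hZ1 bZ1).
have bZ2 z : normc z < 1 -> normc (Z2 z) <= normc z.
  move=> zD; rewrite normcM ler_piMr ?normc_ge0// bK1//.
  exact: le_lt_trans (bZ1 z zD) zD.
exists Z1, Z2; split.
- apply: (schur_class_star_holo hZ1 (holo_comp_disc hK2 hZ2 bZ2)) => //.
  by rewrite /Z2 mul0r.
- apply: (schur_class_star_holo hZ2 (holo_comp_disc hK1 hZ1 bZ1)) => //.
  by rewrite Z10.
move=> z; rewrite unit_discE => zD.
have Z1D := le_lt_trans (bZ1 z zD) zD; have Z2D := le_lt_trans (bZ2 z zD) zD.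
have E1 : Z1 z * Z2 z = z * Qfun mu1 (Z1 z) by rewrite QK1// /Z2 mulrCA.
have E2 : Z1 z * Z2 z = z * Qfun mu2 (Z2 z).
  by rewrite QK2// {1}Z1E// -/(Z2 z) -mulrA [K2 _ * _]mulrC.
split=> //; have [z0|z0] := eqVneq z 0; last by apply: (mulfI z0); rewrite -E1 -E2.
by rewrite QK1// QK2// z0 /Z2 Z10 !mul0r.
Qed.

End Solutions.

Theorem theorem2p7 (R : realType) (mu1 mu2 : probability (borel_circle R) R)
    (hmu1 : nonzero_mean mu1) (hmu2 : nonzero_mean mu2) :
  exists Z1 Z2 : R[i] -> R[i],
    [/\ schur_class_star Z1, schur_class_star Z2,
        (forall z : R[i], unit_disc R z ->
           Z1 z * Z2 z = z * Qfun mu1 (Z1 z) /\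
           Qfun mu1 (Z1 z) = Qfun mu2 (Z2 z)) &
        forall W1 W2 : R[i] -> R[i],
          schur_class_star W1 -> schur_class_star W2 ->
          (forall z : R[i], unit_disc R z ->
             W1 z * W2 z = z * Qfun mu1 (W1 z) /\
             Qfun mu1 (W1 z) = Qfun mu2 (W2 z)) ->
          forall z : R[i], unit_disc R z -> W1 z = Z1 z /\ W2 z = Z2 z].
Proof.
have [Z1 [Z2 [sZ1 sZ2 eqZ]]] := subordination_exists hmu1 hmu2.
exists Z1, Z2; split=> // W1 W2 sW1 sW2 eqW.
exact: subordination_unique hmu1 hmu2 sZ1 sZ2 eqZ sW1 sW2 eqW.
Qed.
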